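(* Assume the standing assumptions (a)–(d) below. Let $\bar\mu,\bar\mu'$ be probability measures on $\mathbb{R}^d$ with finite second moment. Let $T\in(0,\infty)$ and $\epsilon\in[0,\infty)$ satisfy $$LT^2\le \tfrac35\min\Big(\tfrac14,\ \tfrac{3}{256\cdot 5\,L\tilde R^2}\Big),\qquad \epsilon\tilde L\le \frac{5}{64}\,\frac{K}{\sqrt{7/6+3/(2KT^2)}}\exp\Big(-\frac{5\tilde R}{2T}-5\Big).$$ Let $(x,x')$ be any random pair with $x\sim\bar\mu$, $x'\sim\bar\mu'$, and let $\bar{\mathbf X}^{\bar\mu}(x,x')=\bar q_T(x,\xi,\bar\mu)$, $\bar{\mathbf X}'^{\bar\mu'}(x,x')=\bar q_T(x',\eta,\bar\mu')$ be the coupled nHMC transition described below. Then $$\mathbb{E}\big[\rho(\bar{\mathbf X}^{\bar\mu}(x,x'),\bar{\mathbf X}'^{\bar\mu'}(x,x'))\big]\le(1-c)\,\mathbb{E}[\rho(x,x')],\qquad c=\frac{KT^2}{156}\exp\Big(-\frac{5\tilde R}{4T}\Big).$$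
   Context: Standing assumptions: $V:\mathbb{R}^d\to\mathbb{R}$, $W:\mathbb{R}^d\times\mathbb{R}^d\to\mathbb{R}$ are $C^1$, $\nabla_1W$ is the gradient of $W$ in its first argument, and there are constants $L>0$, $K>0$, $\mathcal R\ge0$, $\tilde L\ge0$ with: (a) $V(0)=0$ and $V\ge0$; (b) $|\nabla V(x)-\nabla V(y)|\le L|x-y|$ for all $x,y$; (c) $\langle x-y,\nabla V(x)-\nabla V(y)\rangle\ge K|x-y|^2+L^{-1}|\nabla V(x)-\nabla V(y)|^2$ for all $x,y$ with $|x-y|\ge\mathcal R$; (d) $W(x,y)=W(y,x)$ and $|\nabla_1W(x,y)-\nabla_1W(\tilde x,\tilde y)|\le\tilde L(|x-\tilde x|+|y-\tilde y|)$ for all $x,y,\tilde x,\tilde y$. Constants: $\tilde R=\sqrt{(2L+K)/(6K)}\,\mathcal R$, $R_1=\frac54(\tilde R+2T)$, $\gamma=\min(T^{-1},\tilde R^{-1}/4)$ (with $1/0=\infty$). Metric: $f(r)=\int_0^r\exp(-\min(R_1,s)/T)\,\mathrm{d}s$ and $\rho(x,y)=f(|x-y|)$ on $\mathbb{R}^d$. Nonlinear dynamics: $U_\mu(x)=V(x)+\epsilon\int W(x,u)\mu(\mathrm{d}u)$; for $(x,v)\in\mathbb{R}^{2d}$ and a probability measure $\bar\mu$, $(\bar q_t,\bar p_t)(x,v,\bar\mu)$ solves $\dot{\bar q}_t=\bar p_t$, $\dot{\bar p}_t=-\nabla V(\bar q_t)-\epsilon\int\nabla_1W(\bar q_t,u)\bar\mu_t(\mathrm{d}u)$,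 $(\bar q_0,\bar p_0)=(x,v)$, with $\bar\mu_t=\mathrm{Law}(\bar q_t(\tilde x,\tilde v,\bar\mu))$, $(\tilde x,\tilde v)\sim\bar\mu\otimes\mathcal N(0,I_d)$. Coupling: given $(x,x')$, let $\xi\sim\mathcal N(0,I_d)$ and $\mathcal U\sim\mathrm{Unif}[0,1]$ be independent of each other and of $(x,x')$; put $z=x-x'$, $e=z/|z|$ if $z\ne0$ (else an arbitrary unit vector), $\varphi_{0,1}$ the standard normal density. If $|z|\ge\tilde R$, $\eta=\xi$; otherwise $\eta=\xi+\gamma z$ if $\mathcal U\le\varphi_{0,1}(e\cdot\xi+\gamma|z|)/\varphi_{0,1}(e\cdot\xi)$ and $\eta=\xi-2(e\cdot\xi)e$ else. (Then $\eta\sim\mathcal N(0,I_d)$.) *)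

(* Defs.v *)
From HB Require Import structures.
From mathcomp Require Import all_boot all_order all_algebra.
From mathcomp Require Import all_classical all_reals all_analysis.
Set Implicit Arguments. Unset Strict Implicit. Unset Printing Implicit Defensive.
Import Order.TTheory GRing.Theory Num.Theory.
Import numFieldNormedType.Exports.
Local Open Scope classical_set_scope.
Local Open Scope ring_scope.

Notation vec R d := 'rV[R]_d.

Section Defs.
Context {R : realType} {d : nat}.

Definition dotv (u v : vec R d) : R := \sum_(i < d) u ord0 i * v ord0 i.
Definition enorm (u : vec R d) : R := Num.sqrt (dotv u u).

Definition Rtilde (L K Rc : R) : R := Num.sqrt ((2 * L + K) / (6 * K)) * Rc.
Definition R1 (L K Rc T : R) : R := 5 / 4 * (Rtilde L K Rc + 2 * T).
(* gamma = min(T^-1, Rtilde^-1/4), with 1/0 = +infinity *)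
Definition gammaC (L K Rc T : R) : R :=
  if Rtilde L K Rc == 0 then T^-1 else Num.min T^-1 ((Rtilde L K Rc)^-1 / 4).

Definition fconc (L K Rc T r : R) : R :=
  Rintegral (@lebesgue_measure R) `[0, r]
    (fun s => expR (- Num.min (R1 L K Rc T) s / T)).
Definition rho (L K Rc T : R) (x y : vec R d) : R := fconc L K Rc T (enorm (x - y)).

(* u / |u|, with the convention 0/0 = 0 *)
Definition unitdir (z : vec R d) : vec R d := (enorm z)^-1 *: z.

(* The coupled Gaussian eta, as a function of z = x - x', xi and U. *)
Definition coupled_eta (L K Rc T : R) (z xi : vec R d) (U : R) : vec R d :=
  if Rtilde L K Rc <= enorm z then xi
  else
    let e := unitdir z in
    let g := gammaC L K Rc T in
    if U <= normal_pdf 0 1 (dotv e xi + g * enorm z) / normal_pdf 0 1 (dotv e xi)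
    then xi + g *: z
    else xi - (2 * dotv e xi) *: e.

End Defs.

Section Prob.
Context {R : realType} {dT : measure_display} {Omega : measurableType dT}.

Definition Evec (P : probability Omega R) {d : nat} (F : Omega -> vec R d) : vec R d :=
  \row_(j < d) Rintegral P setT (fun w => F w ord0 j).

Definition sigma_gen (I : Type) (f : I -> Omega -> R) : set (set Omega) :=
  <<s setT, [set A | exists i (B : set R), measurable B /\ A = f i @^-1` B] >>.

Definition indep3 (P : probability Omega R) (F1 F2 F3 : set (set Omega)) : Prop :=
  forall A B C, F1 A -> F2 B -> F3 C ->
    P (A `&` B `&` C) = (P A * P B * P C)%E.

Definition rvec_meas {d : nat} (Y : Omega -> vec R d) : Prop :=
  forall i : 'I_d, measurable_fun setT (fun w => Y w ord0 i).

Definition std_gaussian (P : probability Omega R) {d : nat} (Y : Omega -> vec R d) : Prop :=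
  forall B : 'I_d -> set R, (forall i, measurable (B i)) ->
    P (\bigcap_(i in [set: 'I_d]) [set w | B i (Y w ord0 i)])
    = (\prod_(i < d) normal_prob 0 1 (B i))%E.

Definition unif01 (P : probability Omega R) (Y : Omega -> R) : Prop :=
  forall B : set R, measurable B ->
    P (Y @^-1` B) = uniform_prob (@ltr01 R) B.

Definition finite_second_moment (P : probability Omega R) {d : nat} (Y : Omega -> vec R d) : Prop :=
  (\int[P]_w ((enorm (Y w)) ^+ 2)%:E < +oo)%E.

(* (qb, pb) solves the nonlinear (McKean-Vlasov) Hamiltonian dynamics on [0,T]
   associated with the law mu of X, where the law of (x~, v~) is mu (x) N(0,I)
   realised as the law of (X, G) with X, G independent, G ~ N(0,I):
     d/dt qb = pb,
     d/dt pb = - gV(qb) - eps * int g1W(qb, u) mu_t(du),  mu_t = Law(qb_t(X, G)). *)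
Definition nl_solution (P : probability Omega R) {d : nat}
    (gV : vec R d -> vec R d) (g1W : vec R d -> vec R d -> vec R d) (eps T : R)
    (X G : Omega -> vec R d) (qb pb : R -> vec R d -> vec R d -> vec R d) : Prop :=
  [/\ forall x v, qb 0 x v = x /\ pb 0 x v = v,
      forall x v, {within `[0, T], continuous (fun t => qb t x v)} /\
                  {within `[0, T], continuous (fun t => pb t x v)},
      forall t, 0 <= t <= T -> continuous (fun xv : vec R d * vec R d => qb t xv.1 xv.2),
      forall x v t, 0 < t < T -> is_derive t 1 (fun s => qb s x v) (pb t x v) &
      forall x v t, 0 < t < T -> is_derive t 1 (fun s => pb s x v)
        (- gV (qb t x v) - eps *: Evec P (fun w => g1W (qb t x v) (qb t (X w) (G w))))].

End Prob.

(* Main.v *)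
(** The deterministic forces felt by the two copies differ by the gradients of V and by the
    two mean fields. The laws of the mean fields do not see the coupling of the Gaussians,
    so the mean fields can be compared through the synchronous coupling of the two flows,
    and a Gronwall argument shows that they contribute an error of order
    eps Lt T^2 E|x - x'|. It remains to control f(|z_T|) along a second-order path z.
    - If |z_0| >= Rtilde, the momenta agree, z stays in the region where (c) holds, and a
      time-weighted Lyapunov function contracts |z|.
    - If |z_0| < Rtilde, then on the success event the initial relative momentum is
      (-gamma) z_0 and |z_T| <= (1 - 9/10 gamma T)|z_0|, up to the mean-field error. On the
      failure event |z_T| exceeds |z_0| by at most a multiple of T(1 + |e.xi|), but
      concavity of f weights this increase by exp(-|z_0|/T), and failure has conditional
      probability O(gamma |z_0| (1 + |e.xi|)). Only E[e.xi] = 0 and E[(e.xi)^2] <= 1 are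
      needed to see that success wins on average.
    As f' >= exp(-R1/T), the mean-field error is absorbed in half of the contraction rate. *)

Require Import Defs.
From HB Require Import structures.
From mathcomp Require Import all_boot all_order all_algebra.
From mathcomp Require Import all_classical all_reals all_analysis.
From mathcomp Require Import measurable_realfun ring lra.
Set Implicit Arguments. Unset Strict Implicit. Unset Printing Implicit Defensive.
Import Order.TTheory GRing.Theory Num.Theory.
Import numFieldNormedType.Exports.
Local Open Scope classical_set_scope.
Local Open Scope ring_scope.

(** * Euclidean second-order paths *)

(** The exponent splits as [R1 / T = 5 Rt / (4 T) + 5 / 2]. The piece [5 / 2] lets success win: for
    [r < Rt] the profile is still exponential up to [r + 5 T / 2], and the failure cost is read off
    the tangent there, whose slope is smaller than the one at [r] by the factor [exp(-5/2)]. The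
    same averaging with the tangent at [r] would charge more than success gains. The bound on
    [eps Lt] contains [exp(-R1/T)] squared: one factor turns [E|x - x'|] into [E f(|x - x'|)], the
    other matches the size of the rate. For [d > 0], (c) and Cauchy-Schwarz force [4 K <= L]. Hence
    [K T^2 <= 3/80], and [Rt >= sqrt(3/2) Rc], so a path that starts beyond [Rt] and moves by a
    small fraction of its length stays beyond [Rc]. The distance after the transition is not shown
    to be measurable. It is dominated pathwise by an explicit function of [|x - x'|], [e.xi] and
    [U], which is measurable for the product of the three independent sigma-algebras; Tonelli is
    applied to that bound. *)

Section Euclid.
Context {R : realType} {d : nat}.
Implicit Types u v w : vec R d.

Lemma dotvC u v : dotv u v = dotv v u.
Proof. by apply: eq_bigr => i _; rewrite mulrC. Qed.

Lemma dotvDl u v w : dotv (u + v) w = dotv u w + dotv v w.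
Proof. by rewrite -big_split; apply: eq_bigr => i _; rewrite mxE mulrDl. Qed.

Lemma dotvZl a u v : dotv (a *: u) v = a * dotv u v.
Proof. by rewrite /dotv mulr_sumr; apply: eq_bigr => i _; rewrite mxE mulrA. Qed.

Lemma dotvNl u v : dotv (- u) v = - dotv u v.
Proof. by rewrite -scaleN1r dotvZl mulN1r. Qed.

Lemma dotvDr u v w : dotv u (v + w) = dotv u v + dotv u w.
Proof. by rewrite dotvC dotvDl !(dotvC u). Qed.

Lemma dotvZr a u v : dotv u (a *: v) = a * dotv u v.
Proof. by rewrite dotvC dotvZl (dotvC u). Qed.

Lemma dotvNr u v : dotv u (- v) = - dotv u v.
Proof. by rewrite dotvC dotvNl (dotvC u). Qed.

Lemma dotv0l u : dotv 0 u = 0.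
Proof. by rewrite /dotv big1// => i _; rewrite mxE mul0r. Qed.

Lemma dotv0r u : dotv u 0 = 0.
Proof. by rewrite dotvC dotv0l. Qed.

Lemma dotvBl u v w : dotv (u - v) w = dotv u w - dotv v w.
Proof. by rewrite dotvDl dotvNl. Qed.

Lemma dotvBr u v w : dotv u (v - w) = dotv u v - dotv u w.
Proof. by rewrite dotvDr dotvNr. Qed.

Lemma dotv_ge0 u : 0 <= dotv u u.
Proof. by apply: sumr_ge0 => i _; rewrite -expr2 sqr_ge0. Qed.

Lemma enorm_ge0 u : 0 <= enorm u.
Proof. exact: sqrtr_ge0. Qed.

Lemma enorm_sqr u : enorm u ^+ 2 = dotv u u.
Proof. by rewrite sqr_sqrtr ?dotv_ge0. Qed.

Lemma dotv_eq0 u : dotv u u = 0 -> u = 0.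
Proof.
move=> /eqP; rewrite psumr_eq0 => [/allP h|i _]; last by rewrite -expr2 sqr_ge0.
apply/rowP => i; rewrite mxE; apply/eqP.
by have := h i (mem_index_enum i); rewrite -expr2 sqrf_eq0.
Qed.

Lemma enorm_eq0 u : enorm u = 0 -> u = 0.
Proof. by move=> h; apply: dotv_eq0; rewrite -enorm_sqr h expr0n. Qed.

Lemma enorm0 : enorm (0 : vec R d) = 0.
Proof. by rewrite /enorm dotv0l sqrtr0. Qed.

Lemma enorm_gt0 u : u != 0 -> 0 < enorm u.
Proof.
move=> u0; rewrite lt_neqAle enorm_ge0 andbT eq_sym.
by apply/eqP => /enorm_eq0 /eqP; rewrite (negbTE u0).
Qed.

Lemma enormZ a u : enorm (a *: u) = `|a| * enorm u.
Proof.
by rewrite /enorm dotvZl dotvZr mulrA -expr2 sqrtrM ?sqr_ge0// sqrtr_sqr.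
Qed.

Lemma enormN u : enorm (- u) = enorm u.
Proof. by rewrite -scaleN1r enormZ normrN1 mul1r. Qed.

Lemma enormB u v : enorm (u - v) = enorm (v - u).
Proof. by rewrite -enormN opprB. Qed.

(** Cauchy-Schwarz: with [a = |u|] and [b = |v|], the squared norm of [b u - a v] equals
    [2 a b (a b - <u, v>)]. *)
Lemma dotv_le u v : dotv u v <= enorm u * enorm v.
Proof.
have [->|v0] := eqVneq v 0.
  by rewrite enorm0 mulr0 dotv0r.
have [->|u0] := eqVneq u 0.
  by rewrite enorm0 mul0r dotv0l.
have := dotv_ge0 (enorm v *: u - enorm u *: v).
rewrite dotvBl !dotvBr !dotvZl !dotvZr -!enorm_sqr (dotvC v u).
set a := enorm u; set b := enorm v; set c := dotv u v => h.
have a0 : 0 < a by exact: enorm_gt0.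
have b0 : 0 < b by exact: enorm_gt0.
have ab0 : 0 < a * b by rewrite mulr_gt0.
have : 0 <= (a * b) * (2 * (a * b - c)) by apply: le_trans h _; rewrite le_eqVlt; apply/orP; left; apply/eqP; ring.
rewrite pmulr_rge0//; lra.
Qed.

Lemma enormD u v : enorm (u + v) <= enorm u + enorm v.
Proof.
rewrite -(@ler_pXn2r _ 2)// ?nnegrE ?addr_ge0 ?enorm_ge0//.
rewrite enorm_sqr dotvDl !dotvDr (dotvC v u) -!enorm_sqr.
have := dotv_le u v; rewrite sqrrD; lra.
Qed.

Lemma enormDB u v : enorm u - enorm v <= enorm (u - v).
Proof. by rewrite lerBlDr -{1}(subrK v u) enormD. Qed.

(* The norm is recovered by duality, testing against the vector itself. *)
Lemma enorm_le_dual u (B : R) : 0 <= B ->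
  (forall h, dotv h u <= enorm h * B) -> enorm u <= B.
Proof.
move=> B0 hB; have [->|u0] := eqVneq u 0; first by rewrite enorm0.
have := hB u; rewrite -enorm_sqr expr2 ler_pM2l//; exact: enorm_gt0.
Qed.

Lemma norm_coord_le u i : `|u ord0 i| <= enorm u.
Proof.
rewrite -(@ler_pXn2r _ 2)// ?nnegrE ?enorm_ge0// enorm_sqr -normrX ger0_norm ?sqr_ge0//.
by rewrite /dotv (bigD1 i)//= expr2 lerDl sumr_ge0// => j _; rewrite -expr2 sqr_ge0.
Qed.

Lemma enorm_le_sum u : enorm u <= \sum_(i < d) `|u ord0 i|.
Proof.
have s0 : 0 <= \sum_(i < d) `|u ord0 i| by exact: sumr_ge0.
rewrite -(@ler_pXn2r _ 2)// ?nnegrE ?enorm_ge0// enorm_sqr expr2 mulr_suml.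
apply: ler_sum => i _; apply: le_trans (ler_norm _) _; rewrite normrM.
by rewrite ler_wpM2l// (bigD1 i)//= lerDl sumr_ge0.
Qed.

End Euclid.

Section Paths.
Context {R : realType} {d : nat}.
Implicit Types (z w g : R -> vec R d) (T t s : R).

Lemma within_coord (A : set R) z i : {within A, continuous z} ->
  {within A, continuous (fun t => z t ord0 i)}.
Proof.
move=> cz t.
exact: (@continuous_comp (subspace A) (vec R d) R z (fun v : vec R d => v ord0 i) t (cz t) (@coord_continuous _ _ _ _ _ _)).
Qed.

Lemma within_sum (A : set R) n (f : 'I_n -> R -> R) :
  (forall i, {within A, continuous (f i)}) ->
  {within A, continuous (fun t => \sum_(i < n) f i t)}.
Proof.
elim: n f => [|n ih] f cf.
  under eq_fun do rewrite big_ord0; move=> t; exact: cvg_cst.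
under eq_fun do rewrite big_ord_recr/=.
move=> t; apply: continuousD; last exact: cf.
by apply: (ih (fun i => f (widen_ord (leqnSn n) i))) => i; exact: cf.
Qed.

Lemma within_dotv (A : set R) z w : {within A, continuous z} -> {within A, continuous w} ->
  {within A, continuous (fun t => dotv (z t) (w t))}.
Proof.
move=> cz cw; apply: within_sum => i t.
by apply: continuousM; exact: within_coord.
Qed.

Lemma within_enorm (A : set R) z : {within A, continuous z} ->
  {within A, continuous (fun t => enorm (z t))}.
Proof.
move=> cz t; have /(_ t) h := within_dotv cz cz.
exact: (continuous_cvg _ (@sqrt_continuous R _) h).
Qed.

Lemma is_derive_coord z (l : vec R d) (t : R) (i : 'I_d) : is_derive t 1 z l ->
  is_derive t 1 (fun s => z s ord0 i) (l ord0 i).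
Proof.
move=> [dz <-]; apply: DeriveDef; first by move/derivable_mxP : dz; exact.
by rewrite derive_mx// mxE.
Qed.

Lemma is_derive_dotv z w (z' w' : vec R d) (t : R) :
  is_derive t 1 z z' -> is_derive t 1 w w' ->
  is_derive t 1 (fun s => dotv (z s) (w s)) (dotv z' (w t) + dotv (z t) w').
Proof.
move=> dz dw; rewrite /dotv.
have -> : (fun s => \sum_(i < d) z s ord0 i * w s ord0 i) =
  \sum_(i < d) ((fun s => z s ord0 i) * (fun s => w s ord0 i)).
  by apply/funext => s; rewrite fct_sumE.
rewrite -big_split/=; apply: is_derive_sum => i.
have := is_deriveM (is_derive_coord i dz) (is_derive_coord i dw).
move=> h; apply: is_derive_eq h _.
by rewrite addrC /GRing.scale/=; congr (_ + _); rewrite mulrC.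
Qed.

Lemma le_of_derive_le0 (f df : R -> R) (T : R) : 0 <= T ->
  {within `[0, T], continuous f} ->
  (forall t, 0 < t < T -> is_derive t 1 f (df t)) ->
  (forall t, 0 < t < T -> df t <= 0) ->
  forall t, 0 <= t <= T -> f t <= f 0.
Proof.
move=> T0 cf Hf df0 t /andP[t0 tT].
apply: (@ler0_derive1_le_cc _ f 0 T) => //; rewrite ?in_itv/= ?lexx ?t0 ?tT//.
- by move=> x; rewrite in_itv/= => /Hf [].
- by move=> x; rewrite in_itv/= => xT; rewrite derive1E; have [_ ->] := Hf x xT; exact: df0.
Qed.

(** The motion [z'' = - g] as a first-order system. Later [z], [w] and [g] are the differences of
    the positions, momenta and forces of two copies; derivatives are asked on the open interval
    only, as in [nl_solution]. *)
Definition newton_path T z w g :=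
  [/\ {within `[0, T], continuous z}, {within `[0, T], continuous w} &
      forall t, 0 < t < T -> is_derive t 1 z (w t) /\ is_derive t 1 w (- g t)].

End Paths.

Section Calculus.
Context {R : realType}.
Implicit Types (f g : R -> R) (A : set R) (t a b c : R).

Lemma withinD A f g : {within A, continuous f} -> {within A, continuous g} ->
  {within A, continuous (fun s => f s + g s)}.
Proof. by move=> cf cg t; apply: continuousD; [exact: cf | exact: cg]. Qed.

Lemma withinM A f g : {within A, continuous f} -> {within A, continuous g} ->
  {within A, continuous (fun s => f s * g s)}.
Proof. by move=> cf cg t; apply: continuousM; [exact: cf | exact: cg]. Qed.

Lemma within_cst A c : {within A, continuous (fun=> c : R)}.
Proof. by move=> t; exact: cvg_cst. Qed.

Lemma within_id A : {within A, continuous (fun s : R => s)}.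
Proof. by apply: continuous_subspaceT => t; exact: cvg_id. Qed.

Lemma derD f g t a b : is_derive t 1 f a -> is_derive t 1 g b ->
  is_derive t 1 (fun s => f s + g s) (a + b).
Proof. by move=> hf hg; exact: is_deriveD. Qed.

Lemma derM f g t a b : is_derive t 1 f a -> is_derive t 1 g b ->
  is_derive t 1 (fun s => f s * g s) (a * g t + f t * b).
Proof.
move=> hf hg; apply: is_derive_eq (is_deriveM hf hg) _.
by rewrite addrC /GRing.scale/= [g t * _]mulrC.
Qed.

Lemma derC c t : is_derive t 1 (fun=> c : R) 0.
Proof. exact: is_derive_cst. Qed.

Lemma derid t : is_derive t 1 (fun s : R => s) 1.
Proof. exact: is_derive_id. Qed.

Lemma le_of_derive_le f (df : R -> R) (h : R -> R) (dh : R -> R) (T : R) : 0 <= T ->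
  {within `[0, T], continuous f} -> {within `[0, T], continuous h} ->
  (forall t, 0 < t < T -> is_derive t 1 f (df t)) ->
  (forall t, 0 < t < T -> is_derive t 1 h (dh t)) ->
  (forall t, 0 < t < T -> df t <= dh t) ->
  forall t, 0 <= t <= T -> f t - f 0 <= h t - h 0.
Proof.
move=> T0 cf ch Hf Hh dfh t tT.
have := @le_of_derive_le0 R (fun s => f s + -1 * h s) (fun s => df s + (0 * h s + -1 * dh s)) T T0.
move=> /(_ _ _ _ t tT); rewrite !mulN1r => H.
rewrite lerBlDr addrAC -lerBlDr opprK.
have {}H : f t - h t <= f 0 - h 0.
  apply: H.
  - by apply: withinD => //; apply: withinM => //; exact: within_cst.
  - by move=> s sT; exact: derD (Hf s sT) (derM (derC _ _) (Hh s sT)).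
  - by move=> s sT; have := dfh s sT; lra.
by lra.
Qed.

Lemma le_of_derive2_le (f f1 f2 : R -> R) (T C : R) : 0 <= T ->
  {within `[0, T], continuous f} -> {within `[0, T], continuous f1} ->
  (forall t, 0 < t < T -> is_derive t 1 f (f1 t)) ->
  (forall t, 0 < t < T -> is_derive t 1 f1 (f2 t)) ->
  (forall t, 0 < t < T -> f2 t <= C) -> f 0 = 0 -> f1 0 = 0 ->
  forall t, 0 <= t <= T -> f t <= C * t ^+ 2 / 2.
Proof.
move=> T0 cf cf1 df df1 f2C f0 f10.
have Hf1 t : 0 <= t <= T -> f1 t <= C * t.
  move=> tT.
  have := @le_of_derive_le f1 f2 (fun s => C * s) (fun s => 0 * s + C * 1) T T0 cf1 _ df1 _ _ t tT.
  rewrite f10 mulr0 !subr0; apply => //.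
  - by apply: withinM; [exact: within_cst | exact: within_id].
  - by move=> s _; exact: derM (derC _ _) (derid _).
  - by move=> s sT; rewrite mul0r add0r mulr1; exact: f2C.
move=> t tT.
have := @le_of_derive_le f f1 (fun s => C / 2 * (s * s))
  (fun s => 0 * (s * s) + C / 2 * (1 * s + s * 1)) T T0 cf _ df _ _ t tT.
rewrite f0 !mulr0 !subr0 => H.
rewrite (_ : C * t ^+ 2 / 2 = C / 2 * (t * t)); last by ring.
apply: H.
- by apply: withinM; [exact: within_cst | apply: withinM; exact: within_id].
- by move=> s _; exact: derM (derC _ _) (derM (derid _) (derid _)).
- move=> s /andP[s0 sT]; have H1 : 0 <= s <= T by rewrite !ltW.
  by have := Hf1 s H1; lra.
Qed.

End Calculus.

Section PathEstimates.
Context {R : realType} {d : nat}.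
Implicit Types (z w g : R -> vec R d) (T t s : R).

Lemma is_derive_dotvl (h : vec R d) z (z' : vec R d) (t : R) : is_derive t 1 z z' ->
  is_derive t 1 (fun s => dotv h (z s)) (dotv h z').
Proof.
move=> dz; apply: is_derive_eq (is_derive_dotv (is_derive_cst h t 1) dz) _.
by rewrite dotv0l add0r.
Qed.

Lemma within_dotvl (h : vec R d) z (A : set R) : {within A, continuous z} ->
  {within A, continuous (fun s => dotv h (z s))}.
Proof. by move=> cz; apply: within_dotv => // t; exact: cvg_cst. Qed.

(** For a fixed test vector [h], the scalar function [<h, z t - z 0 - t w 0>] vanishes to first
    order at 0 and its second derivative is at most [|h| B]; duality then returns the norm. *)
Lemma newton_taylor T z w g (B : R) : 0 <= T -> 0 <= B -> newton_path T z w g ->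
  (forall t, 0 < t < T -> enorm (g t) <= B) ->
  forall t, 0 <= t <= T -> enorm (z t - z 0 - t *: w 0) <= B * T ^+ 2 / 2.
Proof.
move=> T0 B0 [cz cw dzw] gB t tT.
have /andP[t0 tT'] := tT.
apply: enorm_le_dual => [|h]; first by rewrite !mulr_ge0// sqr_ge0.
have := @le_of_derive2_le R
  (fun s => dotv h (z s) + (- dotv h (z 0) + - dotv h (w 0) * s))
  (fun s => dotv h (w s) + - dotv h (w 0)) (fun s => dotv h (- g s))
  T (enorm h * B) T0.
move=> /(_ _ _ _ _ _ _ _ t tT) H.
rewrite !dotvBr dotvZr.
have {}H : dotv h (z t) + (- dotv h (z 0) - dotv h (w 0) * t) <= enorm h * B * t ^+ 2 / 2.
  rewrite -mulNr; apply: H.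
  - apply: withinD; first exact: within_dotvl.
    by apply: withinD; [exact: within_cst|apply: withinM; [exact: within_cst|exact: within_id]].
  - by apply: withinD; [exact: within_dotvl|exact: within_cst].
  - move=> s sT; have [dz _] := dzw s sT.
    apply: is_derive_eq (derD (is_derive_dotvl h dz) (derD (derC _ _) (derM (derC _ _) (derid _)))) _.
    by ring.
  - move=> s sT; have [_ dw] := dzw s sT.
    by apply: is_derive_eq (derD (is_derive_dotvl h dw) (derC _ _)) _; ring.
  - move=> s sT; rewrite (le_trans (dotv_le _ _))// enormN.
    by rewrite ler_wpM2l ?enorm_ge0// gB.
  - by ring.
  - by ring.
apply: le_trans (_ : enorm h * B * t ^+ 2 / 2 <= _); first by apply: le_trans H; lra.
have tT2 : t ^+ 2 / 2 <= T ^+ 2 / 2.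
  have : t ^+ 2 <= T ^+ 2 by rewrite ler_pXn2r// nnegrE.
  by lra.
by have := ler_wpM2l (mulr_ge0 (enorm_ge0 h) B0) tT2; lra.
Qed.

Lemma path_sup T z : 0 <= T -> {within `[0, T], continuous z} ->
  exists2 c, 0 <= c <= T & forall t, 0 <= t <= T -> enorm (z t) <= enorm (z c).
Proof.
move=> T0 cz; have [c cT H] := EVT_max T0 (within_enorm cz).
by exists c; [rewrite in_itv in cT | move=> t tT; apply: H; rewrite in_itv].
Qed.

(** Let [S] be the maximum of [|z|]. Taylor gives [S <= A + (l S + b) T^2 / 2], and [l T^2 <= 4/25]
    lets the left side absorb [2/25 S]; this is the origin of [25/23]. *)
Lemma newton_growth T z w g (l b A : R) : 0 <= T -> 0 <= l -> 0 <= b ->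
  l * T ^+ 2 <= 4 / 25 -> newton_path T z w g ->
  (forall t, 0 < t < T -> enorm (g t) <= l * enorm (z t) + b) ->
  (forall t, 0 <= t <= T -> enorm (z 0 + t *: w 0) <= A) ->
  forall t, 0 <= t <= T ->
    enorm (z t) <= 25 / 23 * (A + b * T ^+ 2 / 2) /\
    enorm (z t - z 0 - t *: w 0) <=
      (l * T ^+ 2 * (25 / 23 * (A + b * T ^+ 2 / 2)) + b * T ^+ 2) / 2.
Proof.
move=> T0 l0 b0 lT np gb hA.
have [c cT Hc] := path_sup T0 (let: And3 h _ _ := np in h).
set S := enorm (z c).
have S0 : 0 <= S by exact: enorm_ge0.
have Htay t : 0 <= t <= T -> enorm (z t - z 0 - t *: w 0) <= (l * S + b) * T ^+ 2 / 2.
  apply: (newton_taylor (g := g)) => //; first by rewrite addr_ge0// mulr_ge0.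
  move=> s sT; apply: le_trans (gb s sT) _; rewrite lerD2r ler_wpM2l// Hc//.
  by move: sT => /andP[/ltW-> /ltW->].
have HS : S <= 25 / 23 * (A + b * T ^+ 2 / 2).
  have h1 : S <= A + (l * S + b) * T ^+ 2 / 2.
    have e : z c = (z 0 + c *: w 0) + (z c - z 0 - c *: w 0).
      by apply/rowP => i; rewrite !mxE; ring.
    by rewrite {1}/S [X in enorm X]e; apply: le_trans (enormD _ _) (lerD (hA _ cT) (Htay _ cT)).
  have h2 : (l * T ^+ 2) * S <= 4 / 25 * S by rewrite ler_wpM2r.
  have h3 : (l * S + b) * T ^+ 2 / 2 = (l * T ^+ 2) * S / 2 + b * T ^+ 2 / 2 by ring.
  by rewrite h3 in h1; lra.
move=> t tT; split; first exact: le_trans (Hc t tT) HS.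
apply: le_trans (Htay t tT) _.
have h : l * T ^+ 2 * S <= l * T ^+ 2 * (25 / 23 * (A + b * T ^+ 2 / 2)).
  by rewrite ler_wpM2l// mulr_ge0// sqr_ge0.
by move: h; set X := (25 / 23 * _); lra.
Qed.

(** The term [L^-1 |D|^2] of the coercivity pays for the cross term [<w, D>], the term [K |z|^2] is
    the gain, and the perturbation [p] enters only through its bound [q]. *)
Lemma newton_lyapunov T z w (D p : R -> vec R d) (L K m S q : R) : 0 < T -> 0 < L -> 0 <= K ->
  0 <= m -> 0 <= S -> 0 <= q ->
  L * T ^+ 2 <= 3 / 20 -> newton_path T z w (fun t => D t + p t) -> w 0 = 0 ->
  (forall t, 0 < t < T ->
     K * enorm (z t) ^+ 2 + L^-1 * enorm (D t) ^+ 2 <= dotv (z t) (D t)) ->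
  (forall t, 0 < t < T -> m <= enorm (z t) <= S) ->
  (forall t, 0 < t < T -> enorm (p t) <= q) ->
  enorm (z T) ^+ 2 <= enorm (z 0) ^+ 2 +
    (- 2 * K * m ^+ 2 + 2 * S * q + 21 / 5 * T ^+ 2 * q ^+ 2) * T ^+ 2 / 2.
Proof.
move=> T0 L0 K0 m0 S0 q0 LT [cz cw dzw] w0 coer zS pq.
set C := - 2 * K * m ^+ 2 + _ + _.
have cTt : {within `[0, T], continuous (fun s => T + -1 * s)}.
  apply: withinD; first exact: within_cst.
  by apply: withinM; [exact: within_cst | exact: within_id].
have dTt t : is_derive t 1 (fun s => T + -1 * s) (-1).
  by apply: is_derive_eq (derD (derC _ _) (derM (derC _ _) (derid _))) _; ring.
(* [|z|^2 + 2 (T - s) <z, w> + 5/4 (T - s)^2 |w|^2]: at [s = T] only [|z|^2] is left, and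
   [5/4 > 1] produces the damping term in [|w|^2] that absorbs the forces. *)
pose Phi s := dotv (z s) (z s) + ((2 * (T + -1 * s)) * dotv (z s) (w s) +
  (5 / 4 * ((T + -1 * s) * (T + -1 * s))) * dotv (w s) (w s)).
(* Since [h' = C (T - s)], bounding [Phi'] by [C (T - s)] integrates to [C T^2 / 2]. *)
pose h s := - C / 2 * ((T + -1 * s) * (T + -1 * s)).
have ch : {within `[0, T], continuous h}.
  by apply: withinM; [exact: within_cst | exact: withinM].
have cPhi : {within `[0, T], continuous Phi}.
  apply: withinD; first exact: within_dotv.
  apply: withinD; apply: withinM; try exact: within_dotv.
    by apply: withinM; first exact: within_cst.
  by apply: withinM; [exact: within_cst | exact: withinM].
pose dPhi s := - 1 / 2 * (T - s) * dotv (w s) (w s)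
  - 2 * (T - s) * dotv (z s) (D s + p s)
  - 5 / 2 * (T - s) ^+ 2 * dotv (w s) (D s + p s).
have TT : 0 <= T <= T by rewrite ltW//=.
have := @le_of_derive_le R Phi dPhi h (fun s => C * (T - s)) T (ltW T0) cPhi ch _ _ _ T TT.
rewrite /Phi /h !mulN1r !subrr !(mulr0, mul0r) !subr0 !addr0 w0.
rewrite !dotv0r !mulr0 !addr0 -!enorm_sqr sub0r.
suff H1 : [/\ forall t, 0 < t < T -> is_derive t 1 Phi (dPhi t),
   forall t, 0 < t < T -> is_derive t 1 h (C * (T - t)) &
   forall t, 0 < t < T -> dPhi t <= C * (T - t)].
  by case: H1 => a1 a2 a3 /(_ a1 a2 a3); lra.
split=> t tT.
- have [dz dw] := dzw t tT.
  apply: is_derive_eq (derD (is_derive_dotv dz dz)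
    (derD (derM (derM (derC _ _) (dTt t)) (is_derive_dotv dz dw))
      (derM (derM (derC _ _) (derM (dTt t) (dTt t))) (is_derive_dotv dw dw)))) _.
  rewrite /dPhi dotvNl !dotvNr (dotvC (w t) (z t)) (dotvC (D t + p t) (w t)).
  by field.
- by apply: is_derive_eq (derM (derC _ _) (derM (dTt t) (dTt t))) _; field.
- have := coer t tT; have /andP[mz zS'] := zS t tT; have pq' := pq t tT.
  move: tT => /andP[t0 tT].
  have : dotv (- (w t)) (D t) <= enorm (w t) * enorm (D t) by rewrite -(enormN (w t)) dotv_le.
  have : dotv (- (w t)) (p t) <= enorm (w t) * q.
    apply: le_trans (dotv_le _ _) _; rewrite enormN.
    by rewrite ler_wpM2l ?enorm_ge0.
  have : dotv (- (z t)) (p t) <= S * q.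
    apply: le_trans (dotv_le _ _) _; rewrite enormN.
    by rewrite ler_pM ?enorm_ge0.
  rewrite /dPhi /C !dotvDr !dotvNl -!enorm_sqr.
  have y0 : 0 <= enorm (D t) by exact: enorm_ge0.
  have x0 : 0 <= enorm (w t) by exact: enorm_ge0.
  have z2 : m ^+ 2 <= enorm (z t) ^+ 2 by rewrite ler_pXn2r// ?nnegrE ?enorm_ge0.
  move: y0 x0 z2.
  set x := enorm (w t); set y := enorm (D t); set a := enorm (z t).
  set zD := dotv (z t) (D t); set zp := dotv (z t) (p t).
  set wD := dotv (w t) (D t); set wp := dotv (w t) (p t).
  move=> y0 x0 z2 hzp hwp hwD hzD.
  have tau0 : 0 < T - t by rewrite subr_gt0.
  have tau1 : T - t <= T by rewrite lerBlDr lerDl ltW.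
  move: tau0 tau1; set tau := T - t => tau0 tau1.
  have tau2 : tau ^+ 2 <= T ^+ 2 by rewrite ler_pXn2r// nnegrE ltW.
  have Lt : L * tau ^+ 2 <= 3 / 20 by apply: le_trans LT; rewrite ler_pM2l.
  have hz2 : K * m ^+ 2 <= K * a ^+ 2 by rewrite ler_wpM2l.
  (* Young's inequality, weighted to use exactly the [2 L^-1 |D|^2] that coercivity supplies. Of the
     damping [1/2 |w|^2], [key1] with [key3] takes [25/32 * 3/20] and [key2] takes [19/50], together
     just below [1/2]. *)
  have key1 : 5 / 2 * tau * (x * y) <= 2 * (L^-1 * y ^+ 2) + 25 / 32 * (L * tau ^+ 2) * x ^+ 2.
    have := sqr_ge0 (y - 5 / 8 * L * tau * x); rewrite -(pmulr_rge0 _ (_ : 0 < 2 * L^-1)); last by rewrite mulr_gt0 ?invr_gt0.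
    have -> : 2 * L^-1 * (y - 5 / 8 * L * tau * x) ^+ 2 =
       2 * (L^-1 * y ^+ 2) + 25 / 32 * (L * tau ^+ 2) * x ^+ 2 - 5 / 2 * tau * (x * y).
      by field; rewrite gt_eqF.
    by rewrite subr_ge0.
  have key2 : 5 / 2 * tau * (x * q) <= 19 / 50 * x ^+ 2 + 21 / 5 * (T ^+ 2 * q ^+ 2).
    have := sqr_ge0 (19 / 25 * x - 5 / 2 * (tau * q)).
    have : tau ^+ 2 * q ^+ 2 <= T ^+ 2 * q ^+ 2 by rewrite ler_wpM2r// sqr_ge0.
    have -> : (19 / 25 * x - 5 / 2 * (tau * q)) ^+ 2 =
       361 / 625 * x ^+ 2 - 19 / 5 * (tau * (x * q)) + 25 / 4 * (tau ^+ 2 * q ^+ 2) by field.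
    have : 0 <= tau ^+ 2 * q ^+ 2 by rewrite mulr_ge0 ?sqr_ge0.
    by lra.
  have key3 : (L * tau ^+ 2) * x ^+ 2 <= 3 / 20 * x ^+ 2 by rewrite ler_wpM2r// sqr_ge0.
  have k4 : 5 / 2 * tau * - wD <= 5 / 2 * tau * (x * y).
    by rewrite ler_wpM2l// mulr_ge0// ltW.
  have k5 : 5 / 2 * tau * - wp <= 5 / 2 * tau * (x * q).
    by rewrite ler_wpM2l// mulr_ge0// ltW.
  have x2 : 0 <= x ^+ 2 by rewrite sqr_ge0.
  have fin : - (1 / 2) * x ^+ 2 - 2 * (zD + zp) - 5 / 2 * tau * (wD + wp)
     <= - 2 * (K * m ^+ 2) + 2 * (S * q) + 21 / 5 * (T ^+ 2 * q ^+ 2).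
    move: key1 key2 key3 k4 k5; set e1 := 5 / 2 * tau * (x * y); set e2 := 5 / 2 * tau * (x * q).
    rewrite -[25 / 32 * _ * _]mulrA; set e3 := L * _ * _; set e4 := T ^+ 2 * _.
    move: hz2 hzD hzp; set e5 := K * m ^+ 2; set e6 := K * a ^+ 2; set e7 := L^-1 * _; set e8 := S * q.
    rewrite !mulrN mulrDr; set e9 := 5 / 2 * tau * wD; set e10 := 5 / 2 * tau * wp.
    by lra.
  have := ler_wpM2r (ltW tau0) fin.
  set l1 := (X in X <= _ -> _); set r1 := (X in _ <= X -> _).
  set l2 := (X in _ -> X <= _); set r2 := (X in _ -> _ <= X).
  have -> : l2 = l1 by rewrite /l2 /l1; field.
  have -> : r2 = r1 by rewrite /r2 /r1; field.
  by [].
Qed.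

End PathEstimates.

(** * The concave profile and the deterministic estimates *)

Section ConcaveProfile.
Context {R : realType}.
Variables (L K Rc T : R).
Hypotheses (T0 : 0 < T).
Implicit Types a b r s x : R.
Local Notation mu := (@lebesgue_measure R).
Local Notation f := (fconc L K Rc T).
Local Notation Rc1 := (R1 L K Rc T).

Definition fslope s : R := expR (- Num.min Rc1 s / T).

Lemma fslope_nonincr a b : a <= b -> fslope b <= fslope a.
Proof.
move=> ab; rewrite ler_expR ler_pM2r ?invr_gt0// lerN2.
by rewrite le_min ge_min lexx/= ge_min ab orbT.
Qed.

Lemma fslope_gt0 s : 0 < fslope s. Proof. exact: expR_gt0. Qed.

Lemma fslope_ge s : expR (- Rc1 / T) <= fslope s.
Proof. by rewrite ler_expR ler_pM2r ?invr_gt0// lerN2 ge_min lexx. Qed.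

Lemma fslopeE s : s <= Rc1 -> fslope s = expR (- s / T).
Proof. by move=> sR; rewrite /fslope min_r. Qed.

Lemma continuous_fslope : continuous fslope.
Proof.
move=> s; apply: (cvg_comp _ expR); last exact: continuous_expR.
apply: cvgM; last exact: cvg_cst.
apply: cvgN; apply: (@continuous_min _ _ (fun=> Rc1) id); [exact: cvg_cst | exact: cvg_id].
Qed.

Lemma integrable_fslope a b : mu.-integrable `[a, b] (EFin \o fslope).
Proof.
apply: continuous_compact_integrable; first exact: segment_compact.
by apply: continuous_subspaceT; exact: continuous_fslope.
Qed.

Lemma fconcB a b : 0 <= a -> a <= b -> f b - f a = Rintegral mu `]a, b] fslope.
Proof.
move=> a0 ab; rewrite /fconc -(@Rintegral_itvB _ fslope (BLeft 0) (BRight b) a)//.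
exact: integrable_fslope.
Qed.

Lemma integrable_fslope_oc a b : mu.-integrable `]a, b] (EFin \o fslope).
Proof.
apply: integrableS (integrable_fslope a b) => //; exact: subset_itv_oc_cc.
Qed.

Lemma fine_mu_oc a b : a <= b -> fine (mu `]a, b]) = b - a.
Proof.
move=> ab; rewrite lebesgue_measure_itv/= lte_fin.
case: ltP => [_|ba]; first by rewrite -EFinD.
by rewrite /= (_ : b = a) ?subrr//; apply/eqP; rewrite eq_le ab ba.
Qed.

Lemma integrable_cst_oc a b (c : R) : mu.-integrable `]a, b] (EFin \o fun=> c).
Proof.
apply: (@integrableS _ _ _ mu `[a, b]) => //; first exact: subset_itv_oc_cc.
apply: continuous_compact_integrable; first exact: segment_compact.
by move=> t; exact: cvg_cst.
Qed.

Lemma fconcB_bounds a b : 0 <= a -> a <= b ->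
  fslope b * (b - a) <= f b - f a <= fslope a * (b - a).
Proof.
move=> a0 ab; rewrite fconcB//.
rewrite -(fine_mu_oc ab) -!Rintegral_cst//.
apply/andP; split; apply: le_Rintegral => //;
  try exact: integrable_fslope_oc; try exact: integrable_cst_oc.
  by move=> x /=; rewrite in_itv/= => /andP[_ xb]; exact: fslope_nonincr.
by move=> x /=; rewrite in_itv/= => /andP[ax _]; apply: fslope_nonincr; exact: ltW.
Qed.

(** Concavity in the form used by the coupling estimates: on either side of [a] the increment is
    controlled by the slope at [a]. *)
Lemma fconc_le_tangent a b : 0 <= a -> 0 <= b -> f b <= f a + fslope a * (b - a).
Proof.
move=> a0 b0; have [ab|/ltW ba] := leP a b.
  by have /andP[_] := fconcB_bounds a0 ab; lra.
by have /andP[+ _] := fconcB_bounds b0 ba; lra.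
Qed.

Lemma fconc0 : f 0 = 0.
Proof. by rewrite /fconc set_itv1 Rintegral_set1. Qed.

Lemma fconc_mono a b : 0 <= a -> a <= b -> f a <= f b.
Proof.
move=> a0 ab; have /andP[+ _] := fconcB_bounds a0 ab.
by have := fslope_gt0 b; nra.
Qed.

Lemma fconc_ge0 r : 0 <= r -> 0 <= f r.
Proof. by move=> r0; rewrite -fconc0 fconc_mono. Qed.

Lemma fslope_le1 s : 0 <= Rc1 -> 0 <= s -> fslope s <= 1.
Proof.
move=> R0 s0; rewrite -expR0 ler_expR mulNr oppr_le0; apply: mulr_ge0; last by rewrite invr_ge0 ltW.
by rewrite le_min R0.
Qed.

Lemma fconc_lip a b : 0 <= Rc1 -> 0 <= a -> a <= b -> f b <= f a + (b - a).
Proof.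
move=> R0 a0 ab; have /andP[_] := fconcB_bounds a0 ab.
by have := fslope_le1 R0 a0; nra.
Qed.

Lemma fconc_addr_le a c : 0 <= Rc1 -> 0 <= a -> 0 <= c -> f (a + c) <= f a + c.
Proof.
move=> R0 a0 c0; have ac : a <= a + c by rewrite lerDl.
by have := fconc_lip R0 a0 ac; lra.
Qed.

Lemma fconc_le r : 0 <= Rc1 -> 0 <= r -> f r <= r.
Proof. by move=> R0 r0; have := fconc_lip R0 (lexx 0) r0; rewrite fconc0; lra. Qed.

Lemma fconc_ge r : 0 <= r -> expR (- Rc1 / T) * r <= f r.
Proof.
move=> r0; have /andP[+ _] := fconcB_bounds (lexx 0) r0.
by have := fslope_ge r; rewrite fconc0; nra.
Qed.

(** Below [R1] the profile is [T (1 - exp(-r/T))]. Unlike the endpoint bounds, the exact increment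
    keeps the saturation over a stretch of length comparable to [T]. *)
Lemma fconcB_expR a b : 0 <= a -> a <= b -> b <= Rc1 ->
  f b - f a = T * (expR (- a / T) - expR (- b / T)).
Proof.
move=> a0; rewrite le_eqVlt => /predU1P[->|ab] bR; first by rewrite !subrr mulr0.
rewrite fconcB ?(ltW ab)// /Rintegral.
have dF x : is_derive x 1 (fun s => - T * expR (- s / T)) (expR (- x / T)).
  have h1 : is_derive x 1 (fun s : R => - s / T) (- T^-1).
    rewrite (_ : (fun s => _) = - T^-1 *: (@id R)); last first.
      by apply/funext => s; rewrite fctE/= /GRing.scale/=; ring.
    by apply: is_derive_eq; rewrite /GRing.scale/= mulr1.
  have h2 := @is_derive1_comp R expR (fun s => - s / T) x _ _ (is_derive_expR (- x / T)) h1.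
  rewrite (_ : (fun s => _) = - T *: (expR \o (fun s => - s / T))); last first.
    by apply/funext => s; rewrite fctE.
  apply: is_derive_eq (is_deriveZ (- T) h2) _.
  by rewrite /GRing.scale/=; field; rewrite gt_eqF.
have cF x : {for x, continuous (fun s => - T * expR (- s / T))}.
  by apply/differentiable_continuous/derivable1_diffP; case: (dF x).
rewrite integral_itv_obnd_cbnd; last first.
  by apply/measurable_EFinP; apply: measurable_funTS; apply: continuous_measurable_fun; exact: continuous_fslope.
rewrite (@continuous_FTC2 _ fslope (fun s => - T * expR (- s / T)) a b)//.
- by rewrite -EFinB /=; ring.
- by apply: continuous_subspaceT; exact: continuous_fslope.
- split.
  + by move=> x _; case: (dF x).
  + by apply: cvg_at_right_filter; exact: cF.
  + by apply: cvg_at_left_filter; exact: cF.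
- move=> x; rewrite in_itv/= => /andP[ax xb].
  rewrite derive1E; have [_ ->] := dF x.
  by rewrite fslopeE// ltW// (lt_le_trans xb).
Qed.

Lemma fconc_neg r : r <= 0 -> f r = 0.
Proof.
move=> r0; have [<-|rN0] := eqVneq 0 r; first exact: fconc0.
rewrite /fconc set_itv_ge ?Rintegral_set0// bnd_simp -ltNge lt_neqAle r0.
by rewrite eq_sym rN0.
Qed.

(** The profile vanishes on negative reals and is 1-Lipschitz, hence continuous on the whole
    line. *)
Lemma measurable_fconc : 0 <= Rc1 -> measurable_fun [set: R] f.
Proof.
move=> R0; apply: continuous_measurable_fun => x.
have lip a b : a <= b -> `|f a - f b| <= b - a.
  move=> ab; rewrite distrC.
  have [b0|/ltW b0] := leP b 0.
    by rewrite !fconc_neg ?(le_trans ab)// subrr normr0 subr_ge0.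
  have [a0|/ltW a0] := leP a 0.
    rewrite [f a]fconc_neg// subr0 ger0_norm ?fconc_ge0//.
    by have := fconc_le R0 b0; lra.
  by rewrite ger0_norm ?subr_ge0 ?fconc_mono// lerBlDl fconc_lip.
apply/cvgrPdist_le => /= e e0; near=> y.
have : `|x - y| <= e by near: y; apply: cvgr_dist_le => //; exact: cvg_id.
apply: le_trans; have [xy|/ltW yx] := leP x y.
  by rewrite (distrC x) [leRHS]ger0_norm ?subr_ge0// lip.
by rewrite distrC [leRHS]ger0_norm ?subr_ge0// lip.
Unshelve. all: by end_near. Qed.

End ConcaveProfile.

Section DeterministicContraction.
Context {R : realType} {d : nat}.
Variables (L K Rc T D M : R).
Hypotheses (L0 : 0 < L) (K0 : 0 < K) (Rc0 : 0 <= Rc) (T0 : 0 < T) (D0 : 0 <= D) (M0 : 0 <= M).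
Hypotheses (LT : L * T ^+ 2 <= 3 / 20) (KL : 4 * K <= L) (DK : 1000 * D <= K).
Variables (z w De p : R -> vec R d).
Hypothesis path : newton_path T z w (fun t => De t + p t).
Hypothesis De_le : forall t : R, 0 < t < T -> enorm (De t) <= L * enorm (z t).
Hypothesis p_le : forall t : R, 0 < t < T -> enorm (p t) <= D * (enorm (z t) + M).
Local Notation r := (enorm (z 0)).
Local Notation B := (D * T ^+ 2 * M).

Let l0 : 0 <= L * T ^+ 2. Proof. by rewrite mulr_ge0 ?sqr_ge0 ?ltW. Qed.
Let k0 : 0 <= K * T ^+ 2. Proof. by rewrite mulr_ge0 ?sqr_ge0 ?ltW. Qed.
Let d0 : 0 <= D * T ^+ 2. Proof. by rewrite mulr_ge0 ?sqr_ge0. Qed.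
Let kl : 4 * (K * T ^+ 2) <= L * T ^+ 2.
Proof. by rewrite mulrA ler_wpM2r ?sqr_ge0. Qed.
Let dk : 1000 * (D * T ^+ 2) <= K * T ^+ 2.
Proof. by rewrite mulrA ler_wpM2r ?sqr_ge0. Qed.
Let B0 : 0 <= B. Proof. exact: mulr_ge0. Qed.
Let r0 : 0 <= r. Proof. exact: enorm_ge0. Qed.
Let TT : 0 <= T <= T. Proof. by rewrite lexx ltW. Qed.

(** The total force is at most [(L + D)|z| + D M]. As [D <= K/1000 <= L/4000], the slack between
    [3/20] and [4/25] accommodates [D T^2]. *)
Let growth (A : R) :
  (forall t, 0 <= t <= T -> enorm (z 0 + t *: w 0) <= A) ->
  forall t, 0 <= t <= T ->
    enorm (z t) <= 25 / 23 * (A + B / 2) /\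
    enorm (z t - z 0 - t *: w 0) <=
      ((L + D) * T ^+ 2 * (25 / 23 * (A + B / 2)) + B) / 2.
Proof.
move=> hA t tT.
have := @newton_growth _ _ T z w _ (L + D) (D * M) A (ltW T0) _ _ _ path _ hA t tT.
rewrite (_ : D * M * T ^+ 2 = B); last by ring.
apply.
- by rewrite addr_ge0// ltW.
- exact: mulr_ge0.
- by move: kl dk LT; rewrite mulrDl; lra.
- move=> s sT; apply: le_trans (enormD _ _) _.
  by have := De_le sT; have := p_le sT; lra.
Qed.

Lemma far_contraction :
  w 0 = 0 -> Num.sqrt ((2 * L + K) / (6 * K)) * Rc <= r ->
  (forall t, 0 < t < T -> Rc <= enorm (z t) ->
     K * enorm (z t) ^+ 2 + L^-1 * enorm (De t) ^+ 2 <= dotv (z t) (De t)) ->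
  enorm (z T) <= (1 - 7 / 20 * (K * T ^+ 2)) * r + 8 / 5 * B.
Proof.
move: l0 k0 d0 kl dk B0 r0 LT => l0' k0' d0' kl' dk' B0' r0' LT'.
move=> w0 rRc coer.
have hA t : 0 <= t <= T -> enorm (z 0 + t *: w 0) <= r by rewrite w0 scaler0 addr0.
have kr : K * T ^+ 2 * r <= 3 / 80 * r by apply: ler_wpM2r => //; lra.
(* If [r <= 10 B], the crude growth bound suffices: its excess over the contracted [r] fits into
   [8/5 B]. Otherwise the path stays within 15 percent of [r]. *)
have [Br|rB] := leP (r / 10) B.
  by have [+ _] := growth hA TT; lra.
have rpos : 0 < r by lra.
have lr : (L + D) * T ^+ 2 <= 4 / 25 by rewrite mulrDl; lra.
have zb t : 0 <= t <= T -> 17 / 20 * r <= enorm (z t) <= 23 / 20 * r.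
  move=> tT; have [h1 h2] := growth hA tT.
  rewrite w0 scaler0 subr0 in h2.
  have h3 : (L + D) * T ^+ 2 * (25 / 23 * (r + B / 2)) <= 4 / 25 * (25 / 23 * (r + B / 2)).
    by rewrite ler_wpM2r//; lra.
  have := enormDB (z 0) (z t); rewrite (enormB (z 0)) => h4.
  by apply/andP; split; lra.
(* By [4 K <= L] the quantity under the root is at least [3/2], and [(17/20)^2 > 2/3]; so the lower
   bound of [zb] keeps the path where [coer] applies. *)
have Rcr : Rc <= 17 / 20 * r.
  have : Rc ^+ 2 * ((2 * L + K) / (6 * K)) <= r ^+ 2.
    rewrite mulrC -(@sqr_sqrtr _ ((2 * L + K) / (6 * K))); last first.
      by rewrite divr_ge0// ?addr_ge0// ?mulr_ge0// ltW.
    rewrite -exprMn ler_pXn2r// nnegrE// mulr_ge0// sqrtr_ge0//.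
  have : 3 / 2 <= (2 * L + K) / (6 * K).
    rewrite ler_pdivlMr; last by rewrite mulr_gt0.
    by have := KL; lra.
  move=> h1 h2.
  have h3 : Rc ^+ 2 * (3 / 2) <= r ^+ 2 by apply: le_trans h2; rewrite ler_wpM2l ?sqr_ge0.
  have h4 : Rc ^+ 2 <= (17 / 20 * r) ^+ 2 by rewrite exprMn; have := sqr_ge0 r; lra.
  by rewrite -(@ler_pXn2r _ 2)// nnegrE// mulr_ge0.
pose q := D * (23 / 20 * r + M).
have q0 : 0 <= q by rewrite mulr_ge0// addr_ge0// mulr_ge0.
have oc t : 0 < t < T -> 0 <= t <= T by move=> /andP[/ltW-> /ltW->].
have := @newton_lyapunov _ _ T z w De p L K (17 / 20 * r) (23 / 20 * r) q
  T0 L0 (ltW K0) _ _ q0 LT path w0 _ _ _.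
have m0 : 0 <= 17 / 20 * r by rewrite mulr_ge0.
have S0 : 0 <= 23 / 20 * r by rewrite mulr_ge0.
move=> /(_ m0 S0) H.
have {}H : enorm (z T) ^+ 2 <= r ^+ 2 + (-2 * K * (17 / 20 * r) ^+ 2 + 2 * (23 / 20 * r) * q + 21 / 5 * T ^+ 2 * q ^+ 2) * T ^+ 2 / 2.
  apply: H => t tT.
  - apply: coer => //; apply: le_trans Rcr _.
    by have /andP[] := zb t (oc t tT).
  - exact: zb (oc t tT).
  - apply: le_trans (p_le tT) _; rewrite ler_wpM2l// lerD2r.
    by have /andP[] := zb t (oc t tT).
have Q0 : 0 <= q * T ^+ 2 by rewrite mulr_ge0 ?sqr_ge0.
have QE : q * T ^+ 2 = 23 / 20 * (D * T ^+ 2 * r) + B by rewrite /q; ring.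
clearbody q.
have dr : D * T ^+ 2 * r <= 1 / 1000 * (K * T ^+ 2 * r).
  by have := ler_wpM2r r0' dk'; lra.
have Qr : q * T ^+ 2 <= 11 / 100 * r by rewrite QE; lra.
have QQ : (q * T ^+ 2) ^+ 2 <= 11 / 100 * r * (q * T ^+ 2) by rewrite expr2 ler_wpM2r.
have QM : r * (q * T ^+ 2) <= r * (23 / 20000 * (K * T ^+ 2 * r) + B).
  by rewrite ler_wpM2l// QE; lra.
have kr2 : 0 <= K * T ^+ 2 * r ^+ 2 by rewrite mulr_ge0 ?sqr_ge0.
have rB0 : 0 <= r * B by rewrite mulr_ge0.
have Z2 : enorm (z T) ^+ 2 <= r ^+ 2 - 7 / 10 * (K * T ^+ 2 * r ^+ 2) + 7 / 5 * (r * B).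
  apply: le_trans H _; rewrite expr2 in QQ. by lra.
have rhs0 : 0 <= (1 - 7 / 20 * (K * T ^+ 2)) * r + 8 / 5 * B.
  have k1 : 0 <= 1 - 7 / 20 * (K * T ^+ 2) by lra.
  by have := mulr_ge0 k1 r0'; lra.
rewrite -(@ler_pXn2r _ 2) ?nnegrE ?enorm_ge0//.
apply: le_trans Z2 _.
have kB : K * T ^+ 2 * (r * B) <= 3 / 80 * (r * B) by apply: ler_wpM2r => //; lra.
have := sqr_ge0 (7 / 20 * (K * T ^+ 2) * r); have := sqr_ge0 (8 / 5 * B).
by lra.
Qed.

(** Free motion ends at [(1 - T g) z 0]. Since [(L + D) T^2 <= 4/25 T g], the forces give back at
    most [2/23 T g r] besides terms in [B], and [2/23 < 1/10]. *)
Lemma near_contraction (g : R) : 0 <= g -> T * g <= 1 -> L * T ^+ 2 <= 3 / 20 * (T * g) ->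
  w 0 = - (g *: z 0) ->
  enorm (z T) <= (1 - 9 / 10 * (T * g)) * r + 8 / 5 * B.
Proof.
move: l0 k0 d0 kl dk B0 r0 LT => l0' k0' d0' kl' dk' B0' r0' LT'.
move=> g0 Tg1 lg w0.
have zt t : z 0 + t *: w 0 = (1 - t * g) *: z 0.
  by rewrite w0 scalerN scalerA scalerBl scale1r.
have hA t : 0 <= t <= T -> enorm (z 0 + t *: w 0) <= r.
  move=> /andP[t0 tT]; rewrite zt enormZ ler_piMl//.
  have tg : t * g <= T * g by rewrite ler_wpM2r.
  have tg0 : 0 <= t * g by rewrite mulr_ge0.
  by rewrite ger0_norm; lra.
have [_ h] := growth hA TT.
have e : z T = (z 0 + T *: w 0) + (z T - z 0 - T *: w 0).
  by apply/rowP => i; rewrite !mxE; ring.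
rewrite e; apply: le_trans (enormD _ _) _; rewrite {1}zt enormZ ger0_norm ?subr_ge0//.
have lr : (L + D) * T ^+ 2 <= 4 / 25 * (T * g) by rewrite mulrDl; lra.
have h3 : (L + D) * T ^+ 2 * (25 / 23 * (r + B / 2)) <= 4 / 25 * (T * g) * (25 / 23 * (r + B / 2)).
  by rewrite ler_wpM2r//; lra.
have h4 : T * g * (25 / 23 * (B / 2)) <= 25 / 23 * (B / 2) by rewrite ler_piMl//; lra.
have h5 : 0 <= T * g * r by rewrite !mulr_ge0// ltW.
by lra.
Qed.

(** The free displacement [2 T a] and its force correction add up to [(2 + 4/23) T a <= 109/50 T a].
    The force due to the initial separation becomes a multiple of [T] through [L T r <= 3/80], which
    gives [21/1000]. *)
Lemma near_growth (a : R) : 0 <= a -> L * T * r <= 3 / 80 -> enorm (w 0) <= 2 * a ->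
  enorm (z T) <= r + T * (109 / 50 * a + 21 / 1000) + 8 / 5 * B.
Proof.
move: l0 k0 d0 kl dk B0 r0 LT => l0' k0' d0' kl' dk' B0' r0' LT'.
move=> a0 lr wa.
have hA t : 0 <= t <= T -> enorm (z 0 + t *: w 0) <= r + 2 * (T * a).
  move=> /andP[t0 tT]; apply: le_trans (enormD _ _) _; rewrite lerD2l enormZ ger0_norm//.
  rewrite mulrCA; apply: ler_pM => //; exact: enorm_ge0.
have [_ h] := growth hA TT.
have e : z T = (z 0 + T *: w 0) + (z T - z 0 - T *: w 0).
  by apply/rowP => i; rewrite !mxE; ring.
rewrite e; apply: le_trans (enormD _ _) _; have := hA T TT.
have Ta : 0 <= T * a by rewrite mulr_ge0// ltW.
have lD : (L + D) * T ^+ 2 <= 4 / 25 by rewrite mulrDl; lra.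
have h3 : (L + D) * T ^+ 2 * (25 / 23 * (2 * (T * a) + B / 2)) <= 4 / 25 * (25 / 23 * (2 * (T * a) + B / 2)).
  by rewrite ler_wpM2r//; lra.
have h4 : L * T ^+ 2 * r <= 3 / 80 * T.
  by rewrite (_ : _ * r = (L * T * r) * T); [rewrite ler_pM2r | ring].
have h5 : D * T ^+ 2 * r <= 1 / 1000 * (L * T ^+ 2 * r).
  have dl : D * T ^+ 2 <= 1 / 1000 * (L * T ^+ 2) by lra.
  by have := ler_wpM2r r0' dl; lra.
by have := T0; lra.
Qed.

End DeterministicContraction.

Lemma Rintegral_prob_cst {R : realType} {dT : measure_display}
  {Omega : measurableType dT} (P : probability Omega R) (c : R) :
  Rintegral P setT (fun=> c) = c.
Proof.
rewrite Rintegral_cst//; have -> : fine (P setT) = 1.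
  exact: (congr1 fine (probability_setT P)).
by rewrite mulr1.
Qed.

(** * Gaussian moments and independence *)

Section GaussianMoments.
Context {R : realType}.
Local Notation mu := (@lebesgue_measure R).

(** The Radon-Nikodym derivative and [normal_pdf] have equal integrals over every measurable set,
    hence agree almost everywhere. *)
Lemma ge0_integral_normal_prob (m s : R) (f : R -> \bar R) : s != 0 ->
  (forall x, (0 <= f x)%E) -> measurable_fun setT f ->
  (\int[normal_prob m s]_x f x = \int[mu]_x (f x * (normal_pdf m s x)%:E))%E.
Proof.
move=> s0 f0 mf.
have dom := normal_prob_dominates m s.
rewrite -(Radon_Nikodym_SigmaFinite.change_of_variables dom f0 measurableT mf).
have mpdf : measurable_fun setT (EFin \o normal_pdf m s).
  by apply/measurable_EFinP; exact: measurable_normal_pdf.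
have irn := Radon_Nikodym_SigmaFinite.f_integrable dom.
apply: ae_eq_integral => //.
- by apply: emeasurable_funM => //; exact: measurable_int irn.
- exact: emeasurable_funM.
- apply: ae_eqe_mul2l => /=; apply: integral_ae_eq => //=.
  move=> E _ mE; rewrite -(Radon_Nikodym_SigmaFinite.f_integral dom mE).
  by [].
Qed.

(** Completing the square: [exp(s x)] times the density of N(0,1) is [exp(s^2/2)] times the density
    of N(s,1). *)
Lemma normal_mgf (s : R) :
  (\int[normal_prob 0 1]_x (expR (s * x))%:E = (expR (s ^+ 2 / 2))%:E)%E.
Proof.
have mexp : measurable_fun setT (fun x : R => expR (s * x)).
  by apply: measurableT_comp => //; exact: measurable_funM.
rewrite ge0_integral_normal_prob ?oner_eq0//; last exact/measurable_EFinP.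
transitivity (\int[mu]_x ((expR (s ^+ 2 / 2))%:E * (normal_pdf s 1 x)%:E))%E.
  apply: eq_integral => x _; rewrite -!EFinM; congr EFin.
  rewrite !normal_pdfE ?oner_eq0// mulrCA [RHS]mulrCA; congr (_ * _).
  by rewrite /normal_fun -!expRD; congr expR; rewrite expr1n; field.
rewrite ge0_integralZl//.
- by rewrite integral_normal_pdf mule1.
- by apply/measurable_EFinP; exact: measurable_normal_pdf.
- by move=> x _; rewrite lee_fin normal_pdf_ge0.
Qed.

(** This one bound reduces integrability and second moments of a Gaussian to its generating
    function. It follows by integrating [exp t + exp(-t) >= 2] twice. *)
Lemma expRDN_ge (y : R) : 2 + y ^+ 2 <= expR y + expR (- y).
Proof.
wlog y0 : y / 0 <= y.
  move=> h; have [|/ltW y0] := leP 0 y; first exact: h.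
  by have := h (- y); rewrite oppr_ge0 opprK sqrrN => /(_ y0); lra.
have dN (t : R) : is_derive t 1 (fun s : R => expR (- s)) (- expR (- t)).
  have h1 : is_derive t 1 (fun s : R => - s) (- 1) by exact: is_deriveN.
  have h2 := @is_derive1_comp R expR (fun s => - s) t _ _ (is_derive_expR (- t)) h1.
  by apply: is_derive_eq h2 _; rewrite mulrN1.
have cN : {within `[0, y], continuous (fun s : R => expR (- s))}.
  apply: continuous_subspaceT => t.
  by apply/differentiable_continuous/derivable1_diffP; case: (dN t).
have cP : {within `[0, y], continuous (fun s : R => expR s)}.
  by apply: continuous_subspaceT => t; exact: continuous_expR.
have cC c : {within `[0, y], continuous (fun _ : R => c : R)} by exact: within_cst.
have := @le_of_derive2_le R (fun t => 2 + -1 * (expR t + expR (- t)))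
  (fun t => -1 * (expR t + -1 * expR (- t))) (fun t => - (expR t + expR (- t))) y (-2) y0.
have yy : 0 <= y <= y by rewrite y0 lexx.
move=> /(_ _ _ _ _ _ _ _ y yy) H.
suff : 2 + -1 * (expR y + expR (- y)) <= - 2 * y ^+ 2 / 2 by lra.
apply: H.
- by apply: withinD => //; apply: withinM => //; exact: withinD.
- by apply: withinM => //; apply: withinD => //; exact: withinM.
- move=> t _; apply: is_derive_eq (derD (derC _ _) (derM (derC _ _) (derD (is_derive_expR t) (dN t)))) _.
  by ring.
- move=> t _; apply: is_derive_eq (derM (derC _ _) (derD (is_derive_expR t) (derM (derC _ _) (dN t)))) _.
  by ring.
- move=> t _; rewrite lerN2.
  have ab : expR t * expR (- t) = 1 by rewrite -expRD subrr expR0.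
  have h : 0 <= (expR t - 1) ^+ 2 * expR (- t) by rewrite mulr_ge0 ?sqr_ge0 ?expR_ge0.
  have e : (expR t - 1) ^+ 2 * expR (- t) =
    expR t * (expR t * expR (- t)) - 2 * (expR t * expR (- t)) + expR (- t) by ring.
  by rewrite e ab in h; lra.
- by rewrite oppr0 expR0; ring.
- by rewrite oppr0 expR0; ring.
Qed.

Context {dT : measure_display} {Omega : measurableType dT} (P : probability Omega R).
Variable Y : Omega -> R.
Hypotheses (mY : measurable_fun setT Y)
  (lawY : forall B : set R, measurable B -> P (Y @^-1` B) = normal_prob 0 1 B).

Let mexp s : measurable_fun setT (fun w => expR (s * Y w)).
Proof. by apply: measurableT_comp => //; exact: measurable_funM. Qed.

Let mgf s : (\int[P]_w (expR (s * Y w))%:E = (expR (s ^+ 2 / 2))%:E)%E.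
Proof.
have mexpx : measurable_fun setT (fun x : R => (expR (s * x))%:E).
  by apply/measurable_EFinP; apply: measurableT_comp => //; exact: measurable_funM.
rewrite -normal_mgf.
have f0 : {in [set: R], forall y : R, (0 <= (expR (s * y))%:E)%E}.
  by move=> x _; rewrite lee_fin expR_ge0.
have mY' : @measurable_fun _ _ Omega (measurableTypeR R) setT Y by exact: mY.
have := @ge0_integral_pushforward _ _ Omega (measurableTypeR R) R Y mY' P setT (fun x => (expR (s * x))%:E) measurableT mexpx f0.
rewrite preimage_setT => <-.
pose m1 : {measure set (measurableTypeR R) -> \bar R} := pushforward P (Y : _ -> measurableTypeR R).
by apply: (@eq_measure_integral _ _ R setT (normal_prob 0 1) (m1 mY')) => A mA _; exact: lawY.
Qed.

Let iexp s : P.-integrable setT (fun w => (expR (s * Y w))%:E).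
Proof.
apply/integrableP; split; first by apply/measurable_EFinP.
under eq_integral do rewrite gee0_abs ?lee_fin ?expR_ge0//.
by rewrite mgf ltry.
Qed.

Lemma gaussian_integrable_sqr : P.-integrable setT (fun w => (Y w ^+ 2)%:E).
Proof.
apply: (le_integrable measurableT) (integrableD measurableT (iexp 1) (iexp (-1))).
- by apply/measurable_EFinP; exact: measurable_funX.
- move=> w _; rewrite !gee0_abs ?lee_fin ?sqr_ge0 ?addr_ge0 ?expR_ge0//.
  by rewrite mul1r mulN1r; have := expRDN_ge (Y w); lra.
Qed.

Lemma gaussian_integrable : P.-integrable setT (fun w => (Y w)%:E).
Proof.
apply: (le_integrable measurableT) (integrableD measurableT (iexp 1) (iexp (-1))).
- exact/measurable_EFinP.
- move=> w _; rewrite [leRHS]gee0_abs ?lee_fin ?addr_ge0 ?expR_ge0//=.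
  rewrite mul1r mulN1r; apply: le_trans (expRDN_ge (Y w)).
  have h := sqr_ge0 (`|Y w| - 1).
  rewrite -(real_normK (num_real (Y w))).
  by move: h; set a := `|Y w|; nra.
Qed.

Let expR_leV (u : R) : u < 1 -> expR u <= (1 - u)^-1.
Proof.
move=> u1; have v0 : 0 < 1 - u by rewrite subr_gt0.
have := expR_ge1Dx (- u); rewrite expRN => h.
by rewrite -[leLHS]invrK lef_pV2 ?posrE ?invr_gt0 ?expR_gt0.
Qed.

(** With [m] the mean, [1 + s m <= exp(s^2/2) <= 1 + s^2] for small [s] of either sign, so
    [|m| <= |s|]. *)
Lemma gaussian_mean0 : Rintegral P setT Y = 0.
Proof.
have key s : s * Rintegral P setT Y + 1 <= expR (s ^+ 2 / 2).
  rewrite -[leRHS]/(fine (expR (s ^+ 2 / 2))%:E) -mgf -/(Rintegral P setT (fun w => expR (s * Y w))).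
  have iY := gaussian_integrable.
  have iZ : P.-integrable setT (EFin \o (fun w => s * Y w)).
    exact: (integrableZl measurableT s iY).
  have i1 : P.-integrable setT (EFin \o (fun _ : Omega => 1 : R)).
    exact: finite_measure_integrable_cst.
  have -> : s * Rintegral P setT Y + 1 = Rintegral P setT (fun w => s * Y w + 1).
    by rewrite RintegralD// RintegralZl// Rintegral_prob_cst.
  apply: le_Rintegral => //; [exact: (integrableD measurableT iZ i1)|exact: iexp|].
  by move=> w _; have := expR_ge1Dx (s * Y w); lra.
set m := Rintegral _ _ _ in key *.
have small s : 0 < s <= 1 -> s * `|m| <= s ^+ 2.
  move=> /andP[s0 s1].
  have s2 : s ^+ 2 <= 1 by rewrite expr_le1// ltW.
  have u1 : s ^+ 2 / 2 < 1 by lra.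
  have h := expR_leV u1.
  have h2 : expR (s ^+ 2 / 2) <= 1 + s ^+ 2.
    apply: le_trans h _; rewrite invf_ple ?posrE; [|lra|have := sqr_ge0 s; lra].
    rewrite -div1r ler_pdivrMr; last by have := sqr_ge0 s; lra.
    have : 0 <= s ^+ 2 * (1 - s ^+ 2) by rewrite mulr_ge0 ?sqr_ge0// subr_ge0.
    by lra.
  have := key s; have := key (- s); rewrite sqrrN.
  have [m0|m0] := leP 0 m; first by rewrite (ger0_norm m0); lra.
  by rewrite (ltr0_norm m0); lra.
apply/eqP; rewrite -normr_eq0; apply/eqP.
apply: le_anti; rewrite normr_ge0 andbT.
rewrite leNgt; apply/negP => m0.
pose s := Num.min 1 (`|m| / 2).
have s0 : 0 < s by rewrite lt_min ltr01 divr_gt0.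
have s1 : s <= 1 by rewrite ge_min lexx.
have sm : s <= `|m| / 2 by rewrite ge_min lexx orbT.
have := small s; rewrite s0 s1 => /(_ isT).
by rewrite expr2 ler_pM2l//; lra.
Qed.

(** Averaging [expRDN_ge] at [s Y] with [s^2 = 2 u] gives [u m <= exp u - 1 <= u / (1 - u)]; small
    [u] forces [m <= 1]. *)
Lemma gaussian_second_moment_le1 : Rintegral P setT (fun w => Y w ^+ 2) <= 1.
Proof.
set m := Rintegral _ _ _.
have key u : 0 < u < 1 -> m * (1 - u) <= 1.
  move=> /andP[u0 u1]; pose s := Num.sqrt (2 * u).
  have s2 : s ^+ 2 = 2 * u by rewrite sqr_sqrtr// mulr_ge0// ltW.
  have iY := gaussian_integrable_sqr.
  have iZ : P.-integrable setT (EFin \o (fun w => 2 * u * Y w ^+ 2)) by exact: (integrableZl measurableT (2 * u) iY).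
  have i2 : P.-integrable setT (EFin \o (fun _ : Omega => 2 : R)).
    exact: finite_measure_integrable_cst.
  have : Rintegral P setT (fun w => 2 * u * Y w ^+ 2 + 2) <=
     Rintegral P setT (fun w => expR (s * Y w) + expR (- s * Y w)).
    apply: le_Rintegral => //.
    - exact: (integrableD measurableT iZ i2).
    - exact: (integrableD measurableT (iexp s) (iexp (- s))).
    by move=> w _; have := expRDN_ge (s * Y w); rewrite exprMn s2 mulNr; lra.
  rewrite (RintegralD measurableT iZ i2) (RintegralD measurableT (iexp s) (iexp (- s))).
  rewrite (RintegralZl (2 * u) measurableT iY) Rintegral_prob_cst.
  have E a : Rintegral P setT (fun w => expR (a * Y w)) = expR (a ^+ 2 / 2) by rewrite /Rintegral mgf.
  rewrite !E sqrrN s2 -/m.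
  rewrite (_ : 2 * u / 2 = u); last by field.
  have h := expR_leV u1.
  move=> h2.
  have h3 : u * m <= (1 - u)^-1 - 1 by lra.
  have e : (1 - u)^-1 - 1 = u / (1 - u) by field; rewrite gt_eqF// subr_gt0.
  by move: h3; rewrite e ler_pM2l// -[_^-1]mul1r ler_pdivlMr// subr_gt0.
rewrite leNgt; apply/negP => m1.
have m0 : 0 < m by apply: lt_trans m1.
(* For this [u] one has [m (1 - u) = (m + 1) / 2], which exceeds 1 if [m] does. *)
have := key ((m - 1) / (2 * m)).
rewrite divr_gt0 ?subr_gt0 ?mulr_gt0//= ltr_pdivrMr ?mulr_gt0// mul1r.
have -> : m * (1 - (m - 1) / (2 * m)) = (m + 1) / 2 by field; rewrite gt_eqF.
have -> : m - 1 < 2 * m by lra.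
move=> /(_ isT); lra.
Qed.

End GaussianMoments.

Section IndependentTonelli.
Context {R : realType} {dT : measure_display} {Omega : measurableType dT}.
Variable P : probability Omega R.
Local Open Scope ereal_scope.

Section SubSigma.
Variable G : set (set Omega).
Hypothesis GM : G `<=` @measurable _ Omega.

Lemma sub_sigma_measurable : <<s G >> `<=` @measurable _ Omega.
Proof. by apply: smallest_sub => //; exact: sigma_algebra_measurable. Qed.

Lemma measurable_sub_id :
  measurable_fun setT (idfun : Omega -> g_sigma_algebraType G).
Proof. by move=> _ A mA; rewrite setTI; exact: sub_sigma_measurable. Qed.

Definition sub_id : {mfun Omega >-> g_sigma_algebraType G} :=
  mfun_Sub (mem_set measurable_sub_id).

(** The restriction of [P] to a sub-sigma-algebra, as an image under the identity of [Omega]: random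
    variables are kept as functions on [Omega] instead of being factored through their laws. *)
Definition sub_prob : probability (g_sigma_algebraType G) R := distribution P sub_id.

Lemma ge0_integral_sub_prob (f : g_sigma_algebraType G -> \bar R) :
  measurable_fun setT f -> (forall y, 0 <= f y) ->
  \int[sub_prob]_y f y = \int[P]_w f w.
Proof. by move=> mf f0; rewrite ge0_integral_distribution. Qed.

End SubSigma.

Variables G1 G2 G3 : set (set Omega).
Hypothesis GM1 : G1 `<=` @measurable _ Omega.
Hypothesis GM2 : G2 `<=` @measurable _ Omega.
Hypothesis GM3 : G3 `<=` @measurable _ Omega.
Hypothesis ind : indep3 P <<s G1 >> <<s G2 >> <<s G3 >>.
Local Notation T1 := (g_sigma_algebraType G1).
Local Notation T2 := (g_sigma_algebraType G2).
Local Notation T3 := (g_sigma_algebraType G3).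
Local Notation P1 := (sub_prob GM1).
Local Notation P2 := (sub_prob GM2).
Local Notation P3 := (sub_prob GM3).

Let diag2 (w : Omega) : T2 * T3 := (w, w).
Let diag3 (w : Omega) : T1 * (T2 * T3) := (w, (w, w)).

Let mdiag2 : measurable_fun setT diag2.
Proof.
by apply/measurable_fun_pairP; split; [exact: measurable_sub_id GM2|exact: measurable_sub_id GM3].
Qed.

Let mdiag3 : measurable_fun setT diag3.
Proof.
by apply/measurable_fun_pairP; split; [exact: measurable_sub_id GM1|exact: mdiag2].
Qed.

(** For fixed [A], independence identifies the image of [P] restricted to [A] on rectangles. The
    mass [P A] is moved into the first factor so that uniqueness of product measures applies. *)
Let law23 (A : set Omega) (E : set (T2 * T3)) : <<s G1 >> A -> measurable E ->
  P (A `&` diag2 @^-1` E) = P A * (P2 \x P3) E.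
Proof.
move=> GA mE.
have mA : measurable A by exact: sub_sigma_measurable GM1 _ GA.
pose mR : {measure set Omega -> \bar R} := mrestr P mA.
pose m' : {measure set (T2 * T3) -> \bar R} := pushforward mR diag2.
have a0 : (0 <= fine (P A))%R by rewrite fine_ge0.
have PAE : (fine (P A))%:E = P A by rewrite fineK// fin_num_measure.
pose m1 : {finite_measure set T2 -> \bar R} := mscale (NngNum a0) P2.
have H (B : set T2) (C : set T3) : measurable B -> measurable C ->
    m' mdiag2 (B `*` C) = m1 B * P3 C.
  move=> mB mC; transitivity (P (A `&` B `&` C)).
    rewrite -[LHS]/(P (diag2 @^-1` (B `*` C) `&` A)); congr (P _).
    by apply/seteqP; split => w /=; rewrite /setX/=; tauto.
  by rewrite ind// -[in LHS]PAE.
have := product_measure_unique H mE.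
rewrite -[m' mdiag2 E]/(P (diag2 @^-1` E `&` A)) setIC => <-.
rewrite /product_measure1 ge0_integral_mscale//=.
  by rewrite PAE.
exact: measurable_fun_xsection.
Qed.

(* Independence says that [w |-> (w, (w, w))] pushes [P] forward to the product of the
   restrictions of [P] to the three sigma-algebras. *)
Lemma tonelli_indep3 (F : T1 * (T2 * T3) -> \bar R) :
  measurable_fun setT F -> (forall x, 0 <= F x) ->
  \int[P]_w F (w, (w, w)) =
  \int[P]_w1 \int[P]_w2 \int[P]_w3 F (w1, (w2, w3)).
Proof.
move=> mF F0.
have := @ge0_integral_pushforward _ _ _ _ R diag3 mdiag3 P setT F measurableT mF (fun y _ => F0 y).
rewrite preimage_setT => <-.
pose m' : {measure set (T1 * (T2 * T3))%type -> \bar R} := pushforward P diag3.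
pose m23 : probability (T2 * T3)%type R := P2 \x P3.
transitivity (\int[P1 \x m23]_x F x).
  have H A : measurable A -> A `<=` setT -> m' mdiag3 A = (P1 \x m23) A.
    by move=> mA _; apply/esym; exact: (@product_measure_unique _ _ _ _ R P1 m23 (m' mdiag3)).
  exact: (eq_measure_integral (P1 \x m23) H).
rewrite fubini_tonelli1// /fubini_F.
have mF1 x : measurable_fun setT (fun y => F (x, y)).
  by apply: measurableT_comp => //; exact: pair1_measurable.
rewrite ge0_integral_sub_prob; last 2 first.
- exact: (measurable_fun_fubini_tonelli_F (m2 := m23)).
- by move=> y; exact: integral_ge0.
apply: eq_integral => w1 _.
rewrite (fubini_tonelli1 (fun y => F (w1, y)))// /fubini_F.
rewrite ge0_integral_sub_prob; last 2 first.
- exact: (@measurable_fun_fubini_tonelli_F _ _ _ _ R P3 (fun y => F (w1, y))).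
- by move=> y; exact: integral_ge0.
apply: eq_integral => w2 _.
rewrite ge0_integral_sub_prob//.
by apply: (measurableT_comp (mF1 w1)); exact: pair1_measurable.
Qed.

End IndependentTonelli.

Section GaussianVector.
Context {R : realType} {dT : measure_display} {Omega : measurableType dT}.
Variable P : probability Omega R.
Local Notation N01 := (@normal_prob R 0 1).
Local Notation RM := (measurableTypeR R).

Lemma normal_prob_id_mean0 :
  N01.-integrable setT (fun x : RM => (x : R)%:E) /\ Rintegral N01 setT (fun x : RM => (x : R)) = 0.
Proof.
have mid : measurable_fun setT (fun x : RM => x : R) by move=> _ B mB; rewrite setTI.
by split; [apply: gaussian_integrable mid _ | apply: gaussian_mean0 mid _].
Qed.

(** Agreement on rectangles makes the joint law a product of two Gaussians, and the inner integral
    of Fubini is a vanishing mean. *)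
Lemma gaussian_cross_moment (Y Z : Omega -> R) :
  measurable_fun setT Y -> measurable_fun setT Z ->
  P.-integrable setT (fun w => (Y w * Z w)%:E) ->
  (forall A B : set R, measurable A -> measurable B ->
     P (Y @^-1` A `&` Z @^-1` B) = (N01 A * N01 B)%E) ->
  Rintegral P setT (fun w => Y w * Z w) = 0.
Proof.
move=> mY mZ iYZ law.
have [iid id0] := normal_prob_id_mean0.
have ifin : ((\int[N01]_x `|x%:E|) < +oo)%E by case/integrableP : iid.
pose V (w : Omega) : RM * RM := (Y w, Z w).
have mV : measurable_fun setT V.
  apply/measurable_fun_pairP; split; [exact: mY | exact: mZ].
pose m' : {measure set (RM * RM)%type -> \bar R} := pushforward P V.
have H (E : set (RM * RM)) : measurable E -> E `<=` setT -> m' mV E = (N01 \x N01)%E E.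
  move=> mE _; exact/esym/(@product_measure_unique _ _ RM RM R N01 N01 (m' mV)).
have mF : measurable_fun setT (fun x : RM * RM => (x.1 * x.2)%:E).
  apply/measurable_EFinP; apply: measurable_funM.
    exact: (@measurable_fst _ _ RM RM).
  exact: (@measurable_snd _ _ RM RM).
have iF : (N01 \x N01)%E.-integrable setT (fun x : RM * RM => (x.1 * x.2)%:E).
  apply/integrableP; split; first exact: mF.
  have mabs : measurable_fun setT (fun x : RM * RM => `|(x.1 * x.2)%:E|%E).
    exact: measurableT_comp.
  rewrite fubini_tonelli1// /fubini_F.
  have mab : measurable_fun setT (fun y : RM => `|(y : R)%:E|%E).
    by apply: measurableT_comp => //; exact: measurable_int iid.
  rewrite (eq_integral (fun x : RM => (`|(x : R)%:E| * \int[N01]_y `|(y : R)%:E|)%E)); last first.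
    move=> x _; rewrite -ge0_integralZl//.
    by apply: eq_integral => y _; rewrite EFinM abseM.
  rewrite ge0_integralZr//.
  - by rewrite lte_mul_pinfty// ?integral_ge0// ge0_fin_numE// integral_ge0.
  - exact: integral_ge0.
have E1 : (\int[P]_w (Y w * Z w)%:E = \int[N01 \x N01]_x (x.1 * x.2)%:E)%E.
  rewrite -(eq_measure_integral _ H).
  exact/esym/(@integral_pushforward _ _ _ (RM * RM)%type R V mV P setT _ mF iYZ measurableT).
rewrite /Rintegral E1 -integral12_prod_meas1// /fubini_F.
rewrite (eq_integral (fun _ : RM => 0%E)) ?integral0// => x _.
under eq_integral => y _ do rewrite EFinM.
rewrite integralZl// -[X in (_ * X)%E]fineK; last exact: integrable_fin_num.
by rewrite -/(Rintegral N01 setT _) id0 mule0.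
Qed.

Lemma Rintegral_sum (I : Type) (s : seq I) (F : I -> Omega -> R) :
  (forall i, P.-integrable setT (fun w => (F i w)%:E)) ->
  P.-integrable setT (fun w => (\sum_(i <- s) F i w)%:E) /\
  Rintegral P setT (fun w => \sum_(i <- s) F i w) = \sum_(i <- s) Rintegral P setT (F i).
Proof.
move=> iF; elim: s => [|i s [ih1 ih2]].
  under eq_fun do rewrite big_nil.
  split; first exact: (finite_measure_integrable_cst P 0 measurableT).
  by under eq_Rintegral do rewrite big_nil; rewrite Rintegral_prob_cst big_nil.
under eq_fun do rewrite big_cons.
split; first exact: (integrableD measurableT (iF i) ih1).
under eq_Rintegral do rewrite big_cons.
by rewrite big_cons -ih2 (RintegralD measurableT (iF i) ih1).
Qed.

Section Vector.
Context {d : nat} (xi : Omega -> vec R d).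
Hypotheses (mxi : rvec_meas xi) (gxi : std_gaussian P xi).
Local Notation xi_ i := (fun w => xi w ord0 i).

Lemma std_gaussian_pair (i j : 'I_d) (A B : set R) : i != j -> measurable A -> measurable B ->
  P (xi_ i @^-1` A `&` xi_ j @^-1` B) = (N01 A * N01 B)%E.
Proof.
move=> ij mA mB.
pose C k : set R := if k == i then A else if k == j then B else setT.
have mC k : measurable (C k) by rewrite /C; case: ifP => // _; case: ifP.
have := gxi mC; rewrite (_ : \bigcap_(_ in _) _ = xi_ i @^-1` A `&` xi_ j @^-1` B); last first.
  apply/seteqP; split => [w h|w [hA hB] k _].
    by split; [have := h i Logic.I | have := h j Logic.I];
      rewrite /C /= ?eqxx// eq_sym (negbTE ij).
  by rewrite /C /=; case: eqP => [->//|_]; case: eqP => [->//|].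
move=> ->; rewrite (bigD1 i)//= (bigD1 j)//=; last by rewrite eq_sym.
rewrite big1 => [|k /andP[ki kj]]; last first.
  by rewrite /C (negbTE ki) (negbTE kj); exact: (probability_setT N01).
by rewrite mule1 /C eqxx eq_sym (negbTE ij) eqxx.
Qed.

Lemma std_gaussian_marginal (i : 'I_d) (A : set R) : measurable A ->
  P (xi_ i @^-1` A) = N01 A.
Proof.
move=> mA.
pose C k : set R := if k == i then A else setT.
have mC k : measurable (C k) by rewrite /C; case: ifP.
have := gxi mC; rewrite (_ : \bigcap_(_ in _) _ = xi_ i @^-1` A); last first.
  apply/seteqP; split => [w h|w hA k _].
    by have := h i Logic.I; rewrite /C /= eqxx.
  by rewrite /C /=; case: eqP => [->//|_].
move=> ->; rewrite (bigD1 i)//= big1 => [|k ki]; last first.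
  by rewrite /C (negbTE ki); exact: (probability_setT N01).
by rewrite mule1 /C eqxx.
Qed.

Let ixi i : P.-integrable setT (fun w => (xi_ i w)%:E).
Proof. exact: gaussian_integrable (mxi i) (@std_gaussian_marginal i). Qed.

Let ixi2 i : P.-integrable setT (fun w => (xi_ i w ^+ 2)%:E).
Proof. exact: gaussian_integrable_sqr (mxi i) (@std_gaussian_marginal i). Qed.

Let ixixj i j : P.-integrable setT (fun w => (xi_ i w * xi_ j w)%:E).
Proof.
apply: (le_integrable measurableT) (integrableD measurableT (ixi2 i) (ixi2 j)).
  by apply/measurable_EFinP; apply: measurable_funM; exact: mxi.
move=> w _; rewrite [leRHS]gee0_abs ?lee_fin ?addr_ge0 ?sqr_ge0//=.
set a := xi w ord0 i; set b := xi w ord0 j.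
by rewrite ler_norml; apply/andP; split; [have := sqr_ge0 (a + b)|have := sqr_ge0 (a - b)]; nra.
Qed.

Lemma std_gaussian_dot_mean0 (e : vec R d) :
  P.-integrable setT (fun w => (dotv e (xi w))%:E) /\
  Rintegral P setT (fun w => dotv e (xi w)) = 0.
Proof.
have iF i : P.-integrable setT (fun w => (e ord0 i * xi_ i w)%:E).
  exact: (integrableZl measurableT (e ord0 i) (ixi i)).
have [h1 h2] := Rintegral_sum (index_enum 'I_d) iF.
split=> //; rewrite h2 big1// => i _.
by rewrite (RintegralZl _ measurableT (ixi i)) (gaussian_mean0 (mxi i) (@std_gaussian_marginal i)) mulr0.
Qed.

Lemma std_gaussian_dot_second_moment (e : vec R d) :
  P.-integrable setT (fun w => (dotv e (xi w) ^+ 2)%:E) /\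
  Rintegral P setT (fun w => dotv e (xi w) ^+ 2) <= dotv e e.
Proof.
pose F i j w := e ord0 i * e ord0 j * (xi_ i w * xi_ j w).
have iF i j : P.-integrable setT (fun w => (F i j w)%:E).
  exact: (integrableZl measurableT (e ord0 i * e ord0 j) (ixixj i j)).
have FE w : dotv e (xi w) ^+ 2 = \sum_(i < d) \sum_(j < d) F i j w.
  rewrite expr2 /dotv mulr_suml; apply: eq_bigr => i _.
  by rewrite mulr_sumr; apply: eq_bigr => j _; rewrite /F; ring.
have iS i := (Rintegral_sum (index_enum 'I_d) (iF i)).1.
have [h1 h2] := Rintegral_sum (index_enum 'I_d) iS.
split; first by under eq_fun do rewrite FE; exact: h1.
under eq_Rintegral do rewrite FE.
rewrite h2; apply: ler_sum => i _.
rewrite (Rintegral_sum (index_enum 'I_d) (iF i)).2 (bigD1 i)//= big1 ?addr0 => [|j ji].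
  rewrite (RintegralZl _ measurableT (ixixj i i)) -[leRHS]mulr1.
  rewrite ler_wpM2l//; first by rewrite -expr2 sqr_ge0.
  exact: gaussian_second_moment_le1 (mxi i) (@std_gaussian_marginal i).
rewrite (RintegralZl _ measurableT (ixixj i j)) (@gaussian_cross_moment (xi_ i) (xi_ j)) ?mulr0//.
by move=> A B mA mB; apply: std_gaussian_pair; rewrite // eq_sym.
Qed.

End Vector.
End GaussianVector.

(** * The nonlinear flow *)

Section VectorMeasurability.
Context {R : realType} {dT : measure_display} {Omega : measurableType dT}.

(** As [rvec_meas] speaks of coordinates only, the open preimage is written as a countable union of
    boxes with rational centres and radii [1/(n+1)]. *)
Lemma measurable_fun_continuous_vec2 (d1 d2 : nat) (h : vec R d1 * vec R d2 -> R)
    (X : Omega -> vec R d1) (Y : Omega -> vec R d2) :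
  continuous h -> rvec_meas X -> rvec_meas Y ->
  measurable_fun setT (fun w => h (X w, Y w)).
Proof.
move=> /continuousP ch mX mY; apply: (measurability _ (RGenOpens.measurableE R)).
move=> _ [_ [a [b ->] <-]]; rewrite setTI.
have oU : open (h @^-1` `]a, b[%classic) by apply: ch; exact: interval_open.
set U := h @^-1` _ in oU.
pose box (c : 'rV[rat]_d1 * 'rV[rat]_d2 * nat) : set (vec R d1 * vec R d2) :=
  [set u : vec R d1 * vec R d2 | (forall i, `|ratr (c.1.1 ord0 i) - u.1 ord0 i| < c.2.+1%:R^-1) /\
           (forall i, `|ratr (c.1.2 ord0 i) - u.2 ord0 i| < c.2.+1%:R^-1)].
(* Boxes that leave [U] are replaced by the empty set, so that the union runs over a whole countable
   type. *)
pose I c : set (vec R d1 * vec R d2) := if `[< box c `<=` U >] then box c else set0.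
have -> : (fun w => h (X w, Y w)) @^-1` `]a, b[ =
    \bigcup_c ((fun w => (X w, Y w)) @^-1` I c).
  apply/seteqP; split => [w hw|w [c _]]; last first.
    by rewrite /I /=; case: asboolP => // cU /cU.
  have : nbhs (X w, Y w) U by apply: open_nbhs_nbhs; split.
  move=> /nbhs_ballP[e /= e0 eU].
  have [n ne] : exists n : nat, n.+1%:R^-1 < e / 2.
    have [n _ h'] := near_infty_natSinv_lt (PosNum (divr_gt0 e0 (ltr0n R 2))).
    by exists n; exact: (h' n (leqnn n)).
  have rx (x : R) : exists q : rat, `|ratr q - x| < n.+1%:R^-1.
    have n0 : 0 < n.+1%:R^-1 :> R by rewrite invr_gt0 ltr0n.
    have xn : x - n.+1%:R^-1 < x + n.+1%:R^-1 by rewrite ltrD2l gtrN.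
    have [q] := rat_in_itvoo xn.
    by rewrite in_itv/= => qx; exists q; rewrite ltr_distl.
  pose c1 := \row_i (projT1 (cid (rx (X w ord0 i)))).
  pose c2 := \row_i (projT1 (cid (rx (Y w ord0 i)))).
  have bw : box (c1, c2, n) (X w, Y w).
    by split=> i /=; rewrite !mxE; case: cid.
  exists (c1, c2, n) => //; rewrite /I/=; case: asboolP => // -[].
  move=> u [u1 u2]; apply: eU; split; split=> //= i j; rewrite (ord1 i) /ball/=.
    have /= := bw.1 j; have := u1 j.
    rewrite (distrC _ (X w _ _)) => h1 h2.
    have /= -> : X w ord0 j - u.1 ord0 j = (X w ord0 j - ratr (c1 ord0 j)) + (ratr (c1 ord0 j) - u.1 ord0 j) by rewrite subrKA.
    by apply: le_lt_trans (ler_normD _ _) _; rewrite (splitr e) ltrD ?(lt_trans _ ne).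
  have /= := bw.2 j; have := u2 j.
  rewrite (distrC _ (Y w _ _)) => h1 h2.
  have /= -> : Y w ord0 j - u.2 ord0 j = (Y w ord0 j - ratr (c2 ord0 j)) + (ratr (c2 ord0 j) - u.2 ord0 j) by rewrite subrKA.
  by apply: le_lt_trans (ler_normD _ _) _; rewrite (splitr e) ltrD ?(lt_trans _ ne).
apply: countable_bigcupT_measurable => // c.
rewrite /I; case: asboolP => _; last by rewrite preimage_set0.
have m1 (n : nat) (Z : Omega -> vec R n) (q : 'rV[rat]_n) i (e : R) : rvec_meas Z ->
    measurable [set w | `|ratr (q ord0 i) - Z w ord0 i| < e].
  move=> mZ.
  have mz : measurable_fun setT (fun w => `|ratr (q ord0 i) - Z w ord0 i|).
    by apply: measurableT_comp => //; apply: measurable_funB => //; exact: mZ.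
  have -> : [set w | `|ratr (q ord0 i) - Z w ord0 i| < e] =
      setT `&` (fun w => `|ratr (q ord0 i) - Z w ord0 i|) @^-1` `]-oo, e[%classic.
    by rewrite setTI; apply/seteqP; split => w /=; rewrite in_itv.
  exact: mz.
rewrite (_ : _ @^-1` _ =
  (\bigcap_(i in [set: 'I_d1]) [set w | `|ratr (c.1.1 ord0 i) - X w ord0 i| < c.2.+1%:R^-1]) `&`
  (\bigcap_(i in [set: 'I_d2]) [set w | `|ratr (c.1.2 ord0 i) - Y w ord0 i| < c.2.+1%:R^-1])); last first.
  apply/seteqP; split => w /= [h1 h2]; split => i //=; [exact: h1|exact: h2].
by apply: measurableI; apply: fin_bigcap_measurable => // i _; exact: m1.
Qed.

Lemma measurable_fun_continuous_vec (d : nat) (h : vec R d -> R) (X : Omega -> vec R d) :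
  continuous h -> rvec_meas X -> measurable_fun setT (fun w => h (X w)).
Proof.
move=> ch mX.
apply: (@measurable_fun_continuous_vec2 d d (h \o fst) X X) => // u.
by apply: continuous_comp; [apply: cvg_fst; exact: (nbhs_filter u.2) | exact: ch].
Qed.

Lemma lipschitz_continuous_vec (d : nat) (h : vec R d -> R) (C : R) : 0 <= C ->
  (forall u v, `|h u - h v| <= C * enorm (u - v)) -> continuous h.
Proof.
move=> C0 hC u; apply/(@cvgrPdist_le _ _ _ (nbhs u) (nbhs_filter u)) => /= e e0.
pose a := e / (C * d%:R + 1).
have D0 : 0 < C * d%:R + 1 by rewrite ltr_wpDl// mulr_ge0.
have a0 : 0 < a by rewrite divr_gt0.
near=> v; apply: le_trans (hC u v) _.
apply: le_trans (_ : C * (\sum_(i < d) a) <= _).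
  rewrite ler_wpM2l//; apply: le_trans (enorm_le_sum _) _.
  apply: ler_sum => i _; rewrite !mxE.
  move: i; near: v; apply: filter_forall => i.
  apply: (@cvgr_dist_le _ R _ _ _ (fun v : vec R d => v ord0 i) (u ord0 i)) => //.
  exact: coord_continuous.
rewrite sumr_const card_ord -mulr_natr /a.
rewrite (_ : C * _ = e * (C * d%:R / (C * d%:R + 1))); last by ring.
by rewrite ler_piMr ?(ltW e0)// ler_pdivrMr// mul1r lerDl.
Unshelve. all: by end_near. Qed.

Lemma measurable_fun_dotv (d : nat) (X Y : Omega -> vec R d) : rvec_meas X -> rvec_meas Y ->
  measurable_fun setT (fun w => dotv (X w) (Y w)).
Proof. by move=> mX mY; apply: measurable_sum => i; apply: measurable_funM. Qed.

Lemma rvec_measB (d : nat) (X Y : Omega -> vec R d) : rvec_meas X -> rvec_meas Y ->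
  rvec_meas (fun w => X w - Y w).
Proof.
move=> mX mY i; under eq_fun do rewrite !mxE.
by apply: measurable_funB; [exact: mX | exact: mY].
Qed.

Lemma measurable_fun_enorm (d : nat) (X : Omega -> vec R d) : rvec_meas X ->
  measurable_fun setT (fun w => enorm (X w)).
Proof.
move=> mX; have mD := measurable_fun_dotv mX mX.
exact: (measurableT_comp (continuous_measurable_fun (@sqrt_continuous R)) mD).
Qed.

End VectorMeasurability.

Section MeanField.
Context {R : realType} {dT : measure_display} {Omega : measurableType dT}.
Variable P : probability Omega R.

(* Non-integrable integrands get the junk value 0 from the totalised integral. *)
Lemma Rintegral_nonintegrable (f : Omega -> R) : measurable_fun setT f ->
  ~ P.-integrable setT (EFin \o f) -> Rintegral P setT f = 0.
Proof.
move=> mf nf.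
have mEf : measurable_fun setT (EFin \o f) by exact/measurable_EFinP.
rewrite /Rintegral -[X in fine X]/(\int[P]_x (EFin \o f) x)%E integralE.
have p0 : (0 <= \int[P]_x (EFin \o f)^\+ x)%E by exact: integral_ge0.
have n0 : (0 <= \int[P]_x (EFin \o f)^\- x)%E by exact: integral_ge0.
have : ~ ((\int[P]_x (EFin \o f)^\+ x < +oo)%E /\ (\int[P]_x (EFin \o f)^\- x < +oo)%E).
  move=> [pl nl]; apply: nf; apply/integrableP; split => //.
  under eq_integral do rewrite -/((abse \o (EFin \o f)) _) fune_abse.
  rewrite ge0_integralD//; [by rewrite lte_add_pinfty | exact: measurable_funepos | exact: measurable_funeneg].
move: p0 n0; set a := (\int[P]_x _)%E; set b := (\int[P]_x _)%E.
by case: a b => [a| |] [b| |]// _ _; rewrite !ltry => -[].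
Qed.

(** A bounded difference makes [f] and [g] integrable together; if neither is, both integrals have
    the default value 0. This serves [nl_moment], where integrability is still to be proved. *)
Lemma Rintegral_lipschitz (f g : Omega -> R) (C : R) :
  measurable_fun setT f -> measurable_fun setT g -> 0 <= C ->
  (forall w, `|f w - g w| <= C) -> `|Rintegral P setT f - Rintegral P setT g| <= C.
Proof.
move=> mf mg C0 fgC.
have iC : P.-integrable setT (EFin \o (fun=> C)) by exact: finite_measure_integrable_cst.
have aux (u v : Omega -> R) : measurable_fun setT v -> (forall w, `|u w - v w| <= C) ->
    P.-integrable setT (EFin \o u) -> P.-integrable setT (EFin \o v).
  move=> mv uv iu.
  apply: (le_integrable measurableT) (integrableD measurableT (integrable_abse iu) iC).
    exact/measurable_EFinP.
  move=> w _ /=; rewrite lee_fin [leRHS]ger0_norm ?addr_ge0//.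
  have := ler_normB (u w) (u w - v w); rewrite subKr => h.
  by have := uv w; lra.
have [if_|nf] := pselect (P.-integrable setT (EFin \o f)); last first.
  rewrite !Rintegral_nonintegrable ?subrr ?normr0// => ig; apply: nf.
  by apply: aux ig => // w; rewrite distrC.
have ig := aux _ _ mg fgC if_.
rewrite -(RintegralB measurableT if_ ig).
apply: le_trans (le_normr_Rintegral measurableT (integrableB measurableT if_ ig)) _.
rewrite -[leRHS](Rintegral_prob_cst P C); apply: le_Rintegral => //.
exact: (integrable_abse (integrableB measurableT if_ ig)).
Qed.

Variables (d : nat) (g1W : vec R d -> vec R d -> vec R d) (Lt : R).
Hypotheses (Lt0 : 0 <= Lt) (lipW : forall x y x' y',
  enorm (g1W x y - g1W x' y') <= Lt * (enorm (x - x') + enorm (y - y'))).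

Lemma rvec_meas_g1W q (Q : Omega -> vec R d) : rvec_meas Q -> rvec_meas (fun w => g1W q (Q w)).
Proof.
move=> mQ i; apply: (@measurable_fun_continuous_vec _ _ _ d (fun u => g1W q u ord0 i)) => //.
apply: (@lipschitz_continuous_vec _ _ _ Lt) => // u v.
have -> : g1W q u ord0 i - g1W q v ord0 i = (g1W q u - g1W q v) ord0 i by rewrite !mxE.
by apply: le_trans (norm_coord_le _ _) _; apply: le_trans (lipW _ _ _ _) _; rewrite subrr enorm0 add0r.
Qed.

(** A coordinatewise bound, valid before [Q] is known to be integrable. The price is the factor [d],
    harmless for the qualitative moment bound in which it is used. *)
Lemma Evec_lipschitz_state q q' (Q : Omega -> vec R d) : rvec_meas Q ->
  enorm (Evec P (fun w => g1W q (Q w)) - Evec P (fun w => g1W q' (Q w)))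
  <= d%:R * Lt * enorm (q - q').
Proof.
move=> mQ; apply: le_trans (enorm_le_sum _) _.
apply: le_trans (_ : \sum_(i < d) Lt * enorm (q - q') <= _); last first.
  by rewrite sumr_const card_ord -[_ *+ d]mulr_natl mulrA.
apply: ler_sum => i _; rewrite !mxE; apply: Rintegral_lipschitz.
- exact: rvec_meas_g1W.
- exact: rvec_meas_g1W.
- by rewrite mulr_ge0 ?enorm_ge0.
- move=> w; have -> : g1W q (Q w) ord0 i - g1W q' (Q w) ord0 i = (g1W q (Q w) - g1W q' (Q w)) ord0 i by rewrite !mxE.
  apply: le_trans (norm_coord_le _ _) _; apply: le_trans (lipW _ _ _ _) _.
  by rewrite subrr enorm0 addr0.
Qed.

Lemma integrable_g1W q (Q : Omega -> vec R d) i : rvec_meas Q ->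
  P.-integrable setT (fun w => (enorm (Q w))%:E) ->
  P.-integrable setT (fun w => (g1W q (Q w) ord0 i)%:E).
Proof.
move=> mQ iQ.
have iC : P.-integrable setT (EFin \o (fun=> enorm (g1W q 0))) by exact: finite_measure_integrable_cst.
apply: (le_integrable measurableT) (integrableD measurableT iC (integrableZl measurableT Lt iQ)).
  by apply/measurable_EFinP; exact: rvec_meas_g1W.
move=> w _ /=; rewrite lee_fin [leRHS]ger0_norm ?addr_ge0 ?mulr_ge0 ?enorm_ge0//.
apply: le_trans (norm_coord_le _ _) _.
rewrite -[X in enorm X](subrKC (g1W q 0)); apply: le_trans (enormD _ _) _.
by rewrite lerD2l; apply: le_trans (lipW _ _ _ _) _; rewrite subrr enorm0 add0r subr0.
Qed.

(** Pairing with a fixed vector before integrating avoids the factor [d]; integrability permits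
    exchanging the pairing with the expectation. *)
Lemma Evec_lipschitz q q' (Q Q' : Omega -> vec R d) : rvec_meas Q -> rvec_meas Q' ->
  P.-integrable setT (fun w => (enorm (Q w))%:E) ->
  P.-integrable setT (fun w => (enorm (Q' w))%:E) ->
  enorm (Evec P (fun w => g1W q (Q w)) - Evec P (fun w => g1W q' (Q' w)))
  <= Lt * (enorm (q - q') + Rintegral P setT (fun w => enorm (Q w - Q' w))).
Proof.
move=> mQ mQ' iQ iQ'.
have iQQ : P.-integrable setT (fun w => (enorm (Q w - Q' w))%:E).
  apply: (le_integrable measurableT) (integrableD measurableT iQ iQ').
    by apply/measurable_EFinP; apply: measurable_fun_enorm; exact: rvec_measB.
  move=> w _ /=; rewrite lee_fin !ger0_norm ?addr_ge0 ?enorm_ge0//.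
  by rewrite -(enormN (Q' w)) enormD.
have E0 : 0 <= Rintegral P setT (fun w => enorm (Q w - Q' w)).
  by apply: Rintegral_ge0 => w _; exact: enorm_ge0.
apply: enorm_le_dual => [|h]; first by rewrite mulr_ge0// addr_ge0// enorm_ge0.
have i1 i := integrable_g1W q i mQ iQ.
have i2 i := integrable_g1W q' i mQ' iQ'.
have iB i := integrableB measurableT (i1 i) (i2 i).
have iF i : P.-integrable setT (fun w => (h ord0 i * (g1W q (Q w) ord0 i - g1W q' (Q' w) ord0 i))%:E).
  exact: (integrableZl measurableT (h ord0 i) (iB i)).
have [s1 s2] := Rintegral_sum (index_enum 'I_d) iF.
rewrite (_ : dotv h _ = Rintegral P setT (fun w => \sum_(i < d) h ord0 i * (g1W q (Q w) ord0 i - g1W q' (Q' w) ord0 i))); last first.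
  rewrite s2; apply: eq_bigr => i _; rewrite !mxE.
  by rewrite (RintegralZl _ measurableT (iB i)) (RintegralB measurableT (i1 i) (i2 i)).
have iC : P.-integrable setT (EFin \o (fun=> enorm h * Lt * enorm (q - q'))).
  exact: finite_measure_integrable_cst.
have iD := integrableZl measurableT (enorm h * Lt) iQQ.
apply: le_trans (_ : Rintegral P setT (fun w => enorm h * Lt * enorm (q - q') +
   enorm h * Lt * enorm (Q w - Q' w)) <= _); last first.
  rewrite (RintegralD measurableT iC iD) (RintegralZl _ measurableT iQQ) Rintegral_prob_cst.
  by rewrite -mulrDr mulrA.
apply: le_Rintegral => //; first exact: (integrableD measurableT iC iD).
move=> w _; rewrite -mulrDr -mulrA.
rewrite (_ : \sum_(i < d) _ = dotv h (g1W q (Q w) - g1W q' (Q' w))); last first.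
  by apply: eq_bigr => i _; rewrite !mxE.
by apply: le_trans (dotv_le _ _) _; rewrite ler_wpM2l ?enorm_ge0.
Qed.

End MeanField.

Section Gronwall.
Context {R : realType} {d : nat}.
Implicit Types (z w g : R -> vec R d) (T t s : R).

(** The energy [N = |z|^2 + |w|^2] satisfies [N' <= (1 + l) N]. No smallness of [l T^2] enters, so
    that [l] may carry the factor [d] of [Evec_lipschitz_state]. *)
Lemma newton_gronwall T z w g (l : R) : 0 <= T -> 0 <= l -> newton_path T z w g ->
  (forall t, 0 < t < T -> enorm (g t) <= l * enorm (z t)) ->
  forall t, 0 <= t <= T ->
    enorm (z t) <= expR ((1 + l) * T) * (enorm (z 0) + enorm (w 0)).
Proof.
move=> T0 l0 [cz cw dzw] gl t tT.
pose c := 1 + l; have c0 : 0 <= c by rewrite addr_ge0.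
pose N s := dotv (z s) (z s) + dotv (w s) (w s).
have N0 s : 0 <= N s by rewrite addr_ge0 ?dotv_ge0.
have dE s : is_derive s 1 (fun u => expR (- c * u)) (- c * expR (- c * s)).
  have h1 : is_derive s 1 (fun u : R => - c * u) (- c).
    by apply: is_derive_eq (derM (derC _ _) (derid _)) _; ring.
  by apply: is_derive_eq (@is_derive1_comp R expR (fun u => - c * u) s _ _ (is_derive_expR (- c * s)) h1) _; ring.
have cE : {within `[0, T], continuous (fun u => expR (- c * u))}.
  apply: continuous_subspaceT => s.
  by apply/differentiable_continuous/derivable1_diffP; case: (dE s).
have := @le_of_derive_le0 R (fun s => N s * expR (- c * s))
  (fun s => (2 * dotv (z s) (w s) - 2 * dotv (w s) (g s) - c * N s) * expR (- c * s)) T T0.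
move=> /(_ _ _ _ t tT) H.
have {}H : N t * expR (- c * t) <= N 0 * expR (- c * 0).
  apply: H.
  - by apply: withinM => //; apply: withinD; exact: within_dotv.
  - move=> s sT; have [dz dw] := dzw s sT.
    apply: is_derive_eq (derM (derD (is_derive_dotv dz dz) (is_derive_dotv dw dw)) (dE s)) _.
    by rewrite dotvNl dotvNr (dotvC (g s)) (dotvC (w s) (z s)) /N; ring.
  - move=> s sT; apply: mulr_le0_ge0; last exact: expR_ge0.
    have h1 := dotv_le (z s) (w s).
    have h2 := dotv_le (- (w s)) (g s).
    rewrite dotvNl enormN in h2.
    have h3 : enorm (w s) * enorm (g s) <= enorm (w s) * (l * enorm (z s)).
      by rewrite ler_wpM2l ?enorm_ge0// gl.
    have h4 := sqr_ge0 (enorm (z s) - enorm (w s)).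
    have h5 : 0 <= l * (enorm (z s) - enorm (w s)) ^+ 2 by rewrite mulr_ge0.
    by rewrite /N -!enorm_sqr /c; nra.
rewrite mulr0 expR0 mulr1 in H.
have H2 : N t <= N 0 * expR (c * t).
  have := ler_wpM2r (expR_ge0 (c * t)) H; rewrite -mulrA -expRD mulNr addNr expR0 mulr1.
  by [].
move: tT => /andP[t0 tT].
have E1 : 1 <= expR (c * T) by rewrite -expR0 ler_expR mulr_ge0.
have E2 : expR (c * t) <= expR (c * T) by rewrite ler_expR ler_wpM2l.
have z0 := enorm_ge0 (z 0); have w0 := enorm_ge0 (w 0).
rewrite -(@ler_pXn2r _ 2)// ?nnegrE ?mulr_ge0 ?addr_ge0 ?expR_ge0 ?enorm_ge0//.
apply: le_trans (_ : N t <= _); first by rewrite enorm_sqr lerDl dotv_ge0.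
apply: le_trans H2 _; rewrite exprMn mulrC.
apply: ler_pM; rewrite ?expR_ge0//.
  apply: le_trans E2 _; rewrite expr2; apply: ler_peMl => //; exact: expR_ge0.
by rewrite /N -!enorm_sqr sqrrD; have := mulr_ge0 z0 w0; lra.
Qed.

End Gronwall.

Section NonlinearFlow.
Context {R : realType} {dT : measure_display} {Omega : measurableType dT} {d : nat}.
Variable P : probability Omega R.
Variables (gV : vec R d -> vec R d) (g1W : vec R d -> vec R d -> vec R d) (L Lt T eps : R).
Hypotheses (L0 : 0 < L) (Lt0 : 0 <= Lt) (T0 : 0 < T) (eps0 : 0 <= eps).
Hypothesis lipV : forall x y, enorm (gV x - gV y) <= L * enorm (x - y).
Hypothesis lipW : forall x y x' y',
  enorm (g1W x y - g1W x' y') <= Lt * (enorm (x - x') + enorm (y - y')).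
Variable xi : Omega -> vec R d.
Hypotheses (mxi : rvec_meas xi) (ixi : P.-integrable setT (fun w => (enorm (xi w))%:E)).

Definition mean_force (X : Omega -> vec R d) (qb : R -> vec R d -> vec R d -> vec R d)
  (t : R) (q : vec R d) : vec R d := Evec P (fun w => g1W q (qb t (X w) (xi w))).

Lemma nl_path (X X' : Omega -> vec R d) (qb pb qb' pb' : R -> vec R d -> vec R d -> vec R d) x v x' v' :
  nl_solution P gV g1W eps T X xi qb pb -> nl_solution P gV g1W eps T X' xi qb' pb' ->
  newton_path T (fun t => qb t x v - qb' t x' v') (fun t => pb t x v - pb' t x' v')
    (fun t => (gV (qb t x v) - gV (qb' t x' v')) +
      eps *: (mean_force X qb t (qb t x v) - mean_force X' qb' t (qb' t x' v'))).
Proof.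
move=> [_ c1 _ dq dp] [_ c1' _ dq' dp'].
have [cq cp] := c1 x v; have [cq' cp'] := c1' x' v'.
split.
- by move=> t; apply: continuousB; [exact: cq | exact: cq'].
- by move=> t; apply: continuousB; [exact: cp | exact: cp'].
- move=> t tT; split.
    exact: is_deriveB (dq x v t tT) (dq' x' v' t tT).
  apply: is_derive_eq (is_deriveB (dp x v t tT) (dp' x' v' t tT)) _.
  rewrite /mean_force; set F := Evec _ _; set F' := Evec _ _.
  by apply/rowP => i; rewrite !mxE; ring.
Qed.

Lemma nl_meas (X : Omega -> vec R d) (qb pb : R -> vec R d -> vec R d -> vec R d) (t : R) :
  nl_solution P gV g1W eps T X xi qb pb -> rvec_meas X -> 0 <= t <= T ->
  rvec_meas (fun w => qb t (X w) (xi w)).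
Proof.
move=> [_ _ cq _ _] mX tT i.
apply: (@measurable_fun_continuous_vec2 _ _ _ d d (fun u => qb t u.1 u.2 ord0 i)) => // u.
apply: (@continuous_comp _ _ _ (fun u : vec R d * vec R d => qb t u.1 u.2) (fun q : vec R d => q ord0 i)).
  exact: cq.
exact: coord_continuous.
Qed.

Lemma nl_moment (X : Omega -> vec R d) (qb pb : R -> vec R d -> vec R d -> vec R d) :
  nl_solution P gV g1W eps T X xi qb pb -> rvec_meas X ->
  P.-integrable setT (fun w => (enorm (X w))%:E) ->
  exists B : R, forall t, 0 <= t <= T ->
    P.-integrable setT (fun w => (enorm (qb t (X w) (xi w)))%:E) /\
    Rintegral P setT (fun w => enorm (qb t (X w) (xi w))) <= B.
Proof.
move=> sol mX iX.
pose l := L + eps * (d%:R * Lt).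
have l0 : 0 <= l by apply: addr_ge0; [exact: ltW | rewrite !mulr_ge0].
pose C := expR ((1 + l) * T).
have C0 : 0 <= C by exact: expR_ge0.
(* The reference path from [(0, 0)] feels the same mean field, so the two forces differ only through
   the state, and growth in [(x, v)] is at most affine. *)
have bnd x v t : 0 <= t <= T -> enorm (qb t x v - qb t 0 0) <= C * (enorm x + enorm v).
  move=> tT.
  have := newton_gronwall (ltW T0) l0 (nl_path x v 0 0 sol sol) _ tT.
  have [init _ _ _ _] := sol.
  rewrite !(init _ _).1 !(init _ _).2 !subr0; apply=> s sT.
  apply: le_trans (enormD _ _) _; rewrite /l mulrDl lerD//.
  rewrite enormZ ger0_norm// -mulrA ler_wpM2l//.
  apply: Evec_lipschitz_state => //; apply: (nl_meas sol mX).
  by move: sT => /andP[/ltW-> /ltW->].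
have [c0 c0T Hc0] := @path_sup _ _ T (fun t => qb t 0 0) (ltW T0) (let: And5 _ c _ _ _ := sol in (c 0 0).1).
set A := enorm (qb c0 0 0).
have iS := integrableD measurableT iX ixi.
have iCS := integrableZl measurableT C iS.
have iA : P.-integrable setT (EFin \o (fun=> A)) by exact: finite_measure_integrable_cst.
have iM := integrableD measurableT iA iCS.
exists (Rintegral P setT (fun w => A + C * (enorm (X w) + enorm (xi w)))) => t tT.
have le w : enorm (qb t (X w) (xi w)) <= A + C * (enorm (X w) + enorm (xi w)).
  have := enormDB (qb t (X w) (xi w)) (qb t 0 0).
  by have := bnd (X w) (xi w) t tT; have := Hc0 t tT; rewrite -/A; lra.
have mq : measurable_fun setT (fun w => enorm (qb t (X w) (xi w))).
  by apply: measurable_fun_enorm; exact: nl_meas sol mX tT.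
have iq : P.-integrable setT (fun w => (enorm (qb t (X w) (xi w)))%:E).
  apply: (le_integrable measurableT) iM; first exact/measurable_EFinP.
  move=> w _ /=; rewrite lee_fin ger0_norm ?enorm_ge0//.
  by apply: le_trans (le w) (ler_norm _).
split=> //; apply: le_Rintegral => //; exact: iM.
Qed.

(* Both flows are driven by the same Gaussian: a mean field depends only on the law of its
   flow, so the comparison is free to ignore the reflection coupling. *)
Lemma nl_synchronous (X X' : Omega -> vec R d) (qb pb qb' pb' : R -> vec R d -> vec R d -> vec R d) :
  nl_solution P gV g1W eps T X xi qb pb -> nl_solution P gV g1W eps T X' xi qb' pb' ->
  rvec_meas X -> rvec_meas X' ->
  P.-integrable setT (fun w => (enorm (X w))%:E) ->
  P.-integrable setT (fun w => (enorm (X' w))%:E) ->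
  (L + eps * Lt) * T ^+ 2 <= 4 / 25 -> 1000 * (eps * Lt * T ^+ 2) <= 1 ->
  exists M : R, [/\ 0 <= M,
    M <= 11 / 10 * Rintegral P setT (fun w => enorm (X w - X' w)) &
    forall t, 0 <= t <= T -> forall q q',
      enorm (eps *: (mean_force X qb t q - mean_force X' qb' t q'))
        <= eps * Lt * (enorm (q - q') + M)].
Proof.
move=> sol sol' mX mX' iX iX' lT dT1.
have [B HB] := nl_moment sol mX iX.
have [B' HB'] := nl_moment sol' mX' iX'.
pose D t := Rintegral P setT (fun w => enorm (qb t (X w) (xi w) - qb' t (X' w) (xi w))).
have D0 t : 0 <= D t by apply: Rintegral_ge0 => w _; exact: enorm_ge0.
have iDt t : 0 <= t <= T ->
    P.-integrable setT (fun w => (enorm (qb t (X w) (xi w) - qb' t (X' w) (xi w)))%:E).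
  move=> tT; apply: (le_integrable measurableT) (integrableD measurableT (HB t tT).1 (HB' t tT).1).
    apply/measurable_EFinP; apply: measurable_fun_enorm; apply: rvec_measB.
      exact: nl_meas sol mX tT.
    exact: nl_meas sol' mX' tT.
  move=> w _ /=; rewrite lee_fin !ger0_norm ?addr_ge0 ?enorm_ge0//.
  by rewrite -(enormN (qb' _ _ _)) enormD.
have DB t : 0 <= t <= T -> D t <= B + B'.
  move=> tT; have [i1 b1] := HB t tT; have [i2 b2] := HB' t tT.
  apply: le_trans (lerD b1 b2); rewrite -(RintegralD measurableT i1 i2).
  apply: le_Rintegral => //; [exact: iDt|exact: (integrableD measurableT i1 i2)|].
  by move=> w _; rewrite -(enormN (qb' _ _ _)) enormD.
pose S := [set D t | t in [set t | 0 <= t <= T]].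
have T00 : 0 <= (0 : R) <= T by apply/andP; split=> //; exact: ltW.
have supS : has_sup S.
  split; first by exists (D 0), 0.
  by exists (B + B') => _ [t tT <-]; exact: DB.
(* The worst mean distance over time; [nl_moment] makes it finite, which is what allows the
   inequality [ML] below to be solved for [M]. *)
pose M := sup S.
have DM t : 0 <= t <= T -> D t <= M by move=> tT; apply: sup_upper_bound => //; exists t.
have M0 : 0 <= M by apply: le_trans (DM 0 T00).
have force t : 0 <= t <= T -> forall q q',
    enorm (eps *: (mean_force X qb t q - mean_force X' qb' t q')) <= eps * Lt * (enorm (q - q') + M).
  move=> tT q q'; rewrite enormZ ger0_norm// -mulrA ler_wpM2l//.
  have := @Evec_lipschitz _ _ _ P d g1W Lt Lt0 lipW q q' _ _ (nl_meas sol mX tT) (nl_meas sol' mX' tT)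
    (HB t tT).1 (HB' t tT).1.
  by move=> h; apply: le_trans h _; rewrite ler_wpM2l// lerD2l DM.
exists M; split => //.
pose E := Rintegral P setT (fun w => enorm (X w - X' w)).
have iE : P.-integrable setT (fun w => (enorm (X w - X' w))%:E).
  have := iDt 0 T00; have [init _ _ _ _] := sol; have [init' _ _ _ _] := sol'.
  by under eq_fun do rewrite (init _ _).1 (init' _ _).1.
have el0 : 0 <= eps * Lt by rewrite mulr_ge0.
have Dle t : 0 <= t <= T -> D t <= 25 / 23 * (E + eps * Lt * M * T ^+ 2 / 2).
  move=> tT.
  have iC : P.-integrable setT (EFin \o (fun=> 25 / 23 * (eps * Lt * M * T ^+ 2 / 2))).
    exact: finite_measure_integrable_cst.
  have iZ := integrableZl measurableT (25 / 23) iE.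
  apply: le_trans (_ : Rintegral P setT (fun w => 25 / 23 * enorm (X w - X' w) +
     25 / 23 * (eps * Lt * M * T ^+ 2 / 2)) <= _); last first.
    by rewrite (RintegralD measurableT iZ iC) (RintegralZl _ measurableT iE) Rintegral_prob_cst -mulrDr.
  apply: le_Rintegral => //; [exact: iDt|exact: (integrableD measurableT iZ iC)|].
  move=> w _.
  have := @newton_growth _ _ T _ _ _ (L + eps * Lt) (eps * Lt * M) (enorm (X w - X' w)) (ltW T0)
    _ _ lT (nl_path (X w) (xi w) (X' w) (xi w) sol sol') _ _ t tT.
  have [init _ _ _ _] := sol; have [init' _ _ _ _] := sol'.
  rewrite !(init _ _).1 !(init' _ _).1 (init _ _).2 (init' _ _).2.
  move=> H; have [] := H _ _ _ _.
  - by rewrite addr_ge0// ltW.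
  - by rewrite mulr_ge0.
  - move=> s /andP[s0 sT]; apply: le_trans (enormD _ _) _.
    have s1 : 0 <= s <= T by rewrite !ltW.
    by have := force s s1 (qb s (X w) (xi w)) (qb' s (X' w) (xi w)); have := lipV (qb s (X w) (xi w)) (qb' s (X' w) (xi w)); lra.
  - by move=> s sT; rewrite subrr scaler0 addr0.
  by rewrite mulrDr.
have ML : M <= 25 / 23 * (E + eps * Lt * M * T ^+ 2 / 2).
  by apply: ge_sup; [exists (D 0), 0 | move=> _ [t tT <-]; exact: Dle].
(* The coefficient of [M] on the right of [ML] is at most [25/46000], and [25/23] divided by its
   complement is below [11/10]. *)
have := ler_wpM2r M0 dT1; rewrite -/E; lra.
Qed.

End NonlinearFlow.

(** * Numerical consequences of the smallness assumptions, and scalar inputs *)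

Section Constants.
Context {R : realType}.

Lemma expRN52_bounds : 1 / 18 <= expR (- (5 / 2) : R) <= 2 / 15.
Proof.
apply/andP; split.
  have h : 3 / 4 <= expR (- (1 / 4)) :> R.
    by apply: le_trans (expR_ge1Dx _); lra.
  rewrite (_ : - (5 / 2) = 10%:R * (- (1 / 4))); last by field.
  rewrite expRM_natl; apply: le_trans (_ : (3 / 4) ^+ 10 <= _); last first.
    by rewrite ler_pXn2r// nnegrE ?expR_ge0//; lra.
  by rewrite !exprS expr0; lra.
have h : 3 / 2 <= expR (1 / 2) :> R.
  by apply: le_trans (expR_ge1Dx _); lra.
rewrite expRN (_ : 5 / 2 = 5%:R * (1 / 2)); last by field.
rewrite expRM_natl.
have h2 : 15 / 2 <= expR (1 / 2) ^+ 5 :> R.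
  apply: le_trans (_ : (3 / 2) ^+ 5 <= _); last first.
    by rewrite ler_pXn2r// nnegrE ?expR_ge0//; lra.
  by rewrite !exprS expr0; lra.
have p0 : 0 < expR (1 / 2) ^+ 5 :> R by rewrite exprn_gt0// expR_gt0.
by rewrite -div1r ler_pdivrMr//; lra.
Qed.

Variables (L K Rc T D : R).
Hypotheses (L0 : 0 < L) (K0 : 0 < K) (Rc0 : 0 <= Rc) (T0 : 0 < T).
Hypothesis KL : 4 * K <= L.
Local Notation Rt := (Rtilde L K Rc).
Local Notation gam := (gammaC L K Rc T).
Hypothesis hT2 : L * T ^+ 2 <= 3 / 5 *
          (if Rt == 0 then 1 / 4
           else Num.min (1 / 4) (3 / (256 * 5 * L * Rt ^+ 2))).

Lemma Rtilde_ge0 : 0 <= Rt.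
Proof. by rewrite mulr_ge0// sqrtr_ge0. Qed.

Lemma LT2_le : L * T ^+ 2 <= 3 / 20.
Proof.
apply: le_trans hT2 _; case: ifP => _; first by lra.
apply: le_trans (_ : 3 / 5 * (1 / 4) <= _); last by lra.
by rewrite ler_wpM2l// ge_min lexx.
Qed.

(** The square of the left side is [L T^2] times [L Rt^2], and [3/5 * 3/1280 = (3/80)^2]. *)
Lemma LTRt_le : L * T * Rt <= 3 / 80.
Proof.
have Rt0 := Rtilde_ge0.
have [e|Rn0] := eqVneq Rt 0; first by rewrite e mulr0.
have Rtp : 0 < Rt by rewrite lt_neqAle eq_sym Rn0.
have h : L * T ^+ 2 <= 3 / 5 * (3 / (256 * 5 * L * Rt ^+ 2)).
  apply: le_trans hT2 _; rewrite (negbTE Rn0) ler_wpM2l// ge_min lexx orbT//.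
have X0 : 0 <= L * T * Rt by rewrite !mulr_ge0// ltW.
rewrite -(@ler_pXn2r _ 2)// ?nnegrE//.
have LR : 0 < L * Rt ^+ 2 by rewrite mulr_gt0// exprn_gt0.
have := ler_wpM2r (ltW LR) h.
rewrite (_ : 3 / 5 * _ * _ = (3 / 80) ^+ 2); last first.
  by field; rewrite Rn0 gt_eqF.
by rewrite (_ : (L * T * Rt) ^+ 2 = L * T ^+ 2 * (L * Rt ^+ 2)) //; ring.
Qed.

(** The third bound uses one smallness assumption per branch of the minimum: [LT2_le] when
    [gam = 1/T], and [LTRt_le] when [gam = 1/(4 Rt)]. *)
Lemma gammaC_facts : 0 < Rt ->
  [/\ 0 < gam, T * gam <= 1, L * T ^+ 2 <= 3 / 20 * (T * gam) & gam * Rt <= 1 / 4].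
Proof.
move=> Rtp; rewrite /gammaC gt_eqF//.
have Tn : T != 0 by rewrite gt_eqF.
have Rn : Rt != 0 by rewrite gt_eqF.
have h1 : 0 < Num.min T^-1 (Rt^-1 / 4).
  by rewrite lt_min invr_gt0 T0 divr_gt0// invr_gt0.
have h2 : Num.min T^-1 (Rt^-1 / 4) <= T^-1 by rewrite ge_min lexx.
have h3 : Num.min T^-1 (Rt^-1 / 4) <= Rt^-1 / 4 by rewrite ge_min lexx orbT.
split=> //.
- by have := ler_wpM2l (ltW T0) h2; rewrite mulfV.
- have : T^-1 = Num.min T^-1 (Rt^-1 / 4) \/ Rt^-1 / 4 = Num.min T^-1 (Rt^-1 / 4).
    by case: (leP T^-1 (Rt^-1 / 4)) => _; [left|right].
  move=> [<-|<-]; first by rewrite mulfV// mulr1 LT2_le.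
  have h := LTRt_le.
  have TR : 0 < T / Rt by rewrite divr_gt0.
  have := ler_wpM2r (ltW TR) h.
  rewrite (_ : L * T * Rt * (T / Rt) = L * T ^+ 2); last by field.
  by rewrite (_ : 3 / 80 * (T / Rt) = 3 / 20 * (T * (Rt^-1 / 4))) //; field.
- by have := ler_wpM2r (ltW Rtp) h3; rewrite (_ : Rt^-1 / 4 * Rt = 1 / 4) //; field.
Qed.

Local Notation e1 := (expR (- (5 * Rt) / (4 * T))).
Local Notation E := (expR (- (5 / 2)) : R).

Lemma R1_ge0 : 0 <= R1 L K Rc T.
Proof.
by rewrite mulr_ge0// addr_ge0 ?Rtilde_ge0// mulr_ge0// ltW.
Qed.

Lemma expR_R1 : expR (- R1 L K Rc T / T) = e1 * E.
Proof. by rewrite -expRD; congr expR; rewrite /R1; field; rewrite gt_eqF. Qed.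

(** The exponent is twice [- R1 / T]. Since [K T^2 <= 3/80], the root is at least 6, whence
    [5/384 = 5/64 / 6]. *)
Lemma coupling_constant_le :
  D <= 5 / 64 * (K / Num.sqrt (7 / 6 + 3 / (2 * K * T ^+ 2))) *
       expR (- (5 * Rt) / (2 * T) - 5) ->
  D <= 5 / 384 * K * (e1 * E) ^+ 2.
Proof.
move=> hD; apply: le_trans hD _.
rewrite (_ : expR (- (5 * Rt) / (2 * T) - 5) = (e1 * E) ^+ 2); last first.
  by rewrite expr2 -!expRD; congr expR; field; rewrite gt_eqF.
apply: ler_wpM2r; first exact: sqr_ge0.
have k0 : 0 < 2 * K * T ^+ 2 by rewrite !mulr_gt0// exprn_gt0.
have k1 : K * T ^+ 2 <= 3 / 80.
  have : 4 * K * T ^+ 2 <= L * T ^+ 2 by rewrite ler_wpM2r// sqr_ge0.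
  by have := LT2_le; lra.
have h1 : 36 <= 7 / 6 + 3 / (2 * K * T ^+ 2).
  have : 40 <= 3 / (2 * K * T ^+ 2) by rewrite ler_pdivlMr//; lra.
  by lra.
have h2 : 6 <= Num.sqrt (7 / 6 + 3 / (2 * K * T ^+ 2)).
  have e6 : Num.sqrt (6 ^+ 2) = 6 :> R by rewrite sqrtr_sqr ger0_norm.
  rewrite -[leLHS]e6.
  by apply: ler_wsqrtr; lra.
have s0 : 0 < Num.sqrt (7 / 6 + 3 / (2 * K * T ^+ 2)) by apply: lt_le_trans h2.
have : K / Num.sqrt (7 / 6 + 3 / (2 * K * T ^+ 2)) <= K / 6.
  by rewrite ler_pM2l// lef_pV2 ?posrE.
by lra.
Qed.

End Constants.

(** At two points at distance [a >= Rc] with gradient difference of norm [b], [K a^2 + b^2 / L <= a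
    b <= L a^2 / 4 + b^2 / L]. Such points exist because [d > 0]. *)
Lemma quarter_of_coercive {R : realType} {d : nat} (gV : vec R d -> vec R d) (L K Rc : R) :
  (0 < d)%N -> 0 < L -> 0 <= Rc ->
  (forall x y, Rc <= enorm (x - y) ->
          K * enorm (x - y) ^+ 2 + L^-1 * enorm (gV x - gV y) ^+ 2
          <= dotv (x - y) (gV x - gV y)) -> 4 * K <= L.
Proof.
case: d gV => // d gV _ L0 Rc0 coer.
pose x : vec R d.+1 := const_mx (Rc + 1).
have := coer x 0; rewrite subr0.
have h1 : Rc + 1 <= enorm x.
  by have := norm_coord_le x ord0; rewrite mxE ger0_norm// addr_ge0.
have a0 : 0 < enorm x by lra.
move=> /(_ (ltac:(lra))).
have := dotv_le x (gV x - gV 0).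
move: a0; set a := enorm x; set b := enorm _; set s := dotv _ _ => a0 h2 h3.
have h4 := sqr_ge0 (a * L / 2 - b).
have h5 : K * a ^+ 2 + L^-1 * b ^+ 2 <= a * b by exact: le_trans h3 h2.
have h6 : L * (K * a ^+ 2 + L^-1 * b ^+ 2) <= L * (a * b) by rewrite ler_pM2l.
have e : L * (K * a ^+ 2 + L^-1 * b ^+ 2) = L * K * a ^+ 2 + b ^+ 2 by field; rewrite gt_eqF.
rewrite e in h6.
have h7 : (4 * K) * (L * a ^+ 2) <= L * (L * a ^+ 2) by nra.
by move: h7; rewrite ler_pM2r// mulr_gt0// exprn_gt0.
Qed.

(** The integral of a nonnegative function is a supremum over simple functions below it, hence
    monotone irrespective of measurability. *)
Lemma ge0_le_integral_nonmeas {R : realType} {dT : measure_display} {Omega : measurableType dT}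
  (P : {measure set Omega -> \bar R}) (f g : Omega -> \bar R) :
  (forall w, (0 <= f w)%E) -> (forall w, (f w <= g w)%E) ->
  (\int[P]_w f w <= \int[P]_w g w)%E.
Proof.
move=> f0 fg; have g0 w : (0 <= g w)%E by exact: le_trans (f0 w) (fg w).
rewrite !ge0_integralTE//; apply: ge_ereal_sup => _ [h hf <-].
by apply: ereal_sup_ubound; exists h => // w; exact: le_trans (hf w) (fg w).
Qed.

Lemma normal_pdf_ratio {R : realType} (x a : R) :
  normal_pdf 0 1 (x + a) / normal_pdf 0 1 x = expR (- (a * x + a ^+ 2 / 2)).
Proof.
rewrite !normal_pdfE ?oner_eq0//.
have p0 : normal_peak 1 != 0 :> R by rewrite gt_eqF// normal_peak_gt0// oner_eq0.
rewrite -mulf_div divff// mul1r /normal_fun -expRN -expRD; congr expR.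
by rewrite expr1n; field.
Qed.

(** The failure probability of the coupling, through [1 - exp(-y) <= y]. *)
Lemma unif01_tail {R : realType} {dT : measure_display} {Omega : measurableType dT}
  (P : probability Omega R) (U : Omega -> R) (y : R) :
  unif01 P U -> (P [set w | ~~ (U w <= expR (- y))%R] <= (Num.max 0 y)%:E)%E.
Proof.
move=> hU; set p := expR (- y).
have p0 : 0 < p by exact: expR_gt0.
have -> : [set w | ~~ (U w <= p)] = U @^-1` `]p, +oo[%classic.
  by apply/seteqP; split => w /=; rewrite in_itv/= andbT ltNge.
rewrite hU; last exact: measurable_itv.
rewrite /uniform_prob integral_uniform_pdf.
have -> : `]p, +oo[%classic `&` `[0, 1]%classic = `]p, 1]%classic.
  apply/seteqP; split => x /=; rewrite !in_itv/= ?andbT.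
    by move=> [-> /andP[_ ->]].
  by move=> /andP[px x1]; rewrite px x1 (ltW (lt_trans p0 px)).
rewrite (eq_integral (cst 1%E)); last first.
  move=> x; rewrite inE/= in_itv/= => /andP[px x1].
  by rewrite /uniform_pdf (ltW (lt_trans p0 px)) x1/= subr0 invr1.
rewrite integral_cst//= mul1e lebesgue_measure_itv/= lte_fin.
case: ifP => _; last by rewrite lee_fin le_max lexx.
rewrite -EFinD lee_fin le_max; apply/orP; right.
by have := expR_ge1Dx (- y); rewrite -/p; lra.
Qed.

Section SigmaGen.
Context {R : realType} {dT : measure_display} {Omega : measurableType dT}.
Variables (I : Type) (f : I -> Omega -> R).

Definition sigma_gen_base : set (set Omega) :=
  [set A | exists i (B : set R), measurable B /\ A = f i @^-1` B].

Lemma sigma_gen_base_measurable : (forall i, measurable_fun setT (f i)) ->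
  sigma_gen_base `<=` @measurable _ Omega.
Proof. by move=> mf A [i [B [mB ->]]]; rewrite -[X in measurable X]setTI; exact: mf. Qed.

Lemma measurable_fun_sigma_gen i :
  measurable_fun setT (f i : g_sigma_algebraType sigma_gen_base -> R).
Proof.
by move=> _ B mB; rewrite setTI; apply: sub_sigma_algebra; exists i, B.
Qed.

End SigmaGen.

(** * Averaging over the coupling *)

Section CouplingBound.
Context {R : realType}.
Variables (L K Rc T : R).
Local Notation Rt := (Rtilde L K Rc).
Local Notation gam := (gammaC L K Rc T).
Local Notation f := (fconc L K Rc T).
Local Notation E := (expR (- (5 / 2)) : R).
Local Notation e1 := (expR (- (5 * Rt) / (4 * T))).

(* Pathwise upper bound on the distance after one coupled transition, as a function of
   [r = |x - x'|], of the component [s] of the Gaussian along [x - x'] and of the uniform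
   variable [u]; [b] bounds the effect of the two different mean fields. *)
Definition coupling_bound (b r s u : R) : R :=
  if Rt <= r then f ((1 - 7 / 20 * (K * T ^+ 2)) * r + b)
  else if u <= expR (- (gam * r * s + (gam * r) ^+ 2 / 2))
  then f ((1 - 9 / 10 * (T * gam)) * r + b)
  else f (r + T * (109 / 50 * `|s| + 21 / 1000) + b).

Lemma measurable_coupling_bound (b : R) (dS : measure_display) (S : measurableType dS)
    (r s u : S -> R) : 0 < T -> 0 <= R1 L K Rc T ->
  measurable_fun setT r -> measurable_fun setT s -> measurable_fun setT u ->
  measurable_fun setT (fun w => coupling_bound b (r w) (s w) (u w)).
Proof.
move=> T0 R10 mr ms mu; have mf := measurable_fconc T0 R10.
have c (x : R) : measurable_fun setT (fun _ : S => x) by exact: measurable_cst.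
have mgr : measurable_fun setT (fun w => gam * r w) by exact: measurable_funM.
apply: measurable_fun_ifT; first exact: measurable_fun_ler.
  by apply: (measurableT_comp mf); apply: measurable_funD => //; exact: measurable_funM.
apply: measurable_fun_ifT.
- apply: measurable_fun_ler => //; apply: (measurableT_comp (@measurable_expR R)).
  apply: measurableT_comp => //; apply: measurable_funD; first exact: measurable_funM.
  by apply: measurable_funM => //; exact: measurable_funX.
- by apply: (measurableT_comp mf); apply: measurable_funD => //; exact: measurable_funM.
- apply: (measurableT_comp mf); apply: measurable_funD => //; apply: measurable_funD => //.
  apply: measurable_funM => //; apply: measurable_funD => //; apply: measurable_funM => //.
  exact: measurableT_comp.
Qed.

Hypotheses (L0 : 0 < L) (K0 : 0 < K) (Rc0 : 0 <= Rc) (T0 : 0 < T) (KL : 4 * K <= L).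
Hypothesis hT2 : L * T ^+ 2 <= 3 / 5 *
          (if Rt == 0 then 1 / 4
           else Num.min (1 / 4) (3 / (256 * 5 * L * Rt ^+ 2))).
Variable b : R.
Hypothesis b0 : 0 <= b.
Local Notation rate := (K * T ^+ 2 / 156 * e1).

Let k1 : 0 <= K * T ^+ 2 <= 3 / 80.
Proof.
have h : 4 * K * T ^+ 2 <= L * T ^+ 2 by rewrite ler_wpM2r// sqr_ge0.
have h2 := LT2_le hT2; apply/andP; split; last by lra.
by rewrite mulr_ge0 ?sqr_ge0 ?ltW.
Qed.

Let e1_gt0 : 0 < e1. Proof. exact: expR_gt0. Qed.
Let R10 : 0 <= R1 L K Rc T. Proof. exact: R1_ge0. Qed.

Lemma coupling_bound_ge0 (r s u : R) : 0 <= r -> 0 <= coupling_bound b r s u.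
Proof.
move=> r0; have /andP[k0 k2] := k1; rewrite /coupling_bound.
have f0 x : 0 <= f x.
  by have [x0|/ltW x0] := leP 0 x; [exact: fconc_ge0 | rewrite fconc_neg].
by case: ifP => // _; case: ifP.
Qed.

(** The tangent at [r] has slope at least [e1 E] with [E >= 1/18], and [7/20 * 1/18] exceeds
    [2/156]. *)
Lemma coupling_bound_far (r s u : R) : Rt <= r ->
  coupling_bound b r s u <= (1 - 2 * rate) * f r + b.
Proof.
move=> Rr; rewrite /coupling_bound Rr.
have r0 : 0 <= r by apply: le_trans (Rtilde_ge0 _ _ Rc0) Rr.
have /andP[k0 k2] := k1.
set k := K * T ^+ 2 in k0 k2 *.
have x0 : 0 <= (1 - 7 / 20 * k) * r by rewrite mulr_ge0//; lra.
have h1 : f ((1 - 7 / 20 * k) * r + b) <= f ((1 - 7 / 20 * k) * r) + b.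
  exact: fconc_addr_le.
have h2 := fconc_le_tangent L K Rc T0 r0 x0.
have h3 := fslope_ge L K Rc T0 r; rewrite expR_R1// in h3.
have /andP[E1 E2] := @expRN52_bounds R.
have fr0 : 0 <= f r by exact: fconc_ge0.
have frr : f r <= r by exact: fconc_le.
have kr : 0 <= k * r by rewrite mulr_ge0.
have h4 : e1 * E * (k * r) <= fslope L K Rc T r * (k * r) by rewrite ler_wpM2r.
have h5 : e1 / 18 * (k * r) <= e1 * E * (k * r).
  by rewrite ler_wpM2r// ler_pM2l//; lra.
have h6 : e1 * (k * f r) <= e1 * (k * r) by rewrite ler_pM2l// ler_wpM2l.
have h7 : 0 <= e1 * (k * f r) by rewrite !mulr_ge0// ltW.
by lra.
Qed.

Section Near.
Variable r : R.
Hypotheses (r0 : 0 <= r) (rR : r < Rt).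
Local Notation a := (gam * r).
Local Notation tau := (T * expR (- r / T)).

Let Rtp : 0 < Rt. Proof. exact: le_lt_trans r0 rR. Qed.

Let a_bounds : 0 <= a <= 1 / 4.
Proof.
have [g0 _ _ gR] := gammaC_facts L0 Rc0 T0 hT2 Rtp.
apply/andP; split; first by rewrite mulr_ge0// ltW.
by apply: le_trans gR; rewrite ler_pM2l// ltW.
Qed.

Let tau_gt0 : 0 < tau. Proof. by rewrite mulr_gt0// expR_gt0. Qed.

Let rR1 : r + 5 / 2 * T <= R1 L K Rc T.
Proof. by rewrite /R1; have := rR; have := Rtilde_ge0 L K Rc0; lra. Qed.

Lemma near_success_bound :
  f ((1 - 9 / 10 * (T * gam)) * r + b) <= f r - 9 / 10 * tau * a + b.
Proof.
have [g0 Tg _ _] := gammaC_facts L0 Rc0 T0 hT2 Rtp.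
have x0 : 0 <= (1 - 9 / 10 * (T * gam)) * r by rewrite mulr_ge0//; lra.
have h1 : f ((1 - 9 / 10 * (T * gam)) * r + b) <= f ((1 - 9 / 10 * (T * gam)) * r) + b.
  exact: fconc_addr_le.
have := fconc_le_tangent L K Rc T0 r0 x0.
rewrite fslopeE; last by have := rR1; have := T0; lra.
by lra.
Qed.

(** Up to [r + 5 T / 2] the exact increment is [tau (1 - E)]; beyond it the tangent has slope
    [E exp(-r/T)]. The constant collects [1 + 5/2 - 21/1000 = 3479/1000]. *)
Lemma near_failure_bound (s : R) :
  f (r + T * (109 / 50 * `|s| + 21 / 1000) + b) <=
    f r + tau * (1 - 3479 / 1000 * E + 109 / 50 * E * `|s|) + b.
Proof.
have s0 := normr_ge0 s.
have [x xE] : exists x, x = T * (109 / 50 * `|s| + 21 / 1000) by eexists.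
rewrite -xE; have x0 : 0 <= x by rewrite xE; apply: mulr_ge0; [exact: ltW | lra].
have rx0 : 0 <= r + x by rewrite addr_ge0.
have rt0 : 0 <= r + 5 / 2 * T by have := T0; have := r0; lra.
have h1 : f (r + x + b) <= f (r + x) + b.
  exact: fconc_addr_le.
have h2 := fconc_le_tangent L K Rc T0 rt0 rx0.
rewrite fslopeE// in h2.
have rr : r <= r + 5 / 2 * T by have := T0; lra.
have h3 := fconcB_expR T0 r0 rr rR1.
have e : expR (- (r + 5 / 2 * T) / T) = expR (- r / T) * E.
  by rewrite -expRD; congr expR; field; rewrite gt_eqF.
rewrite e in h2 h3.
apply: le_trans h1 _; rewrite lerD2r; apply: le_trans h2 _.
have -> : f (r + 5 / 2 * T) = f r + T * (expR (- r / T) - expR (- r / T) * E) by rewrite -h3; ring.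
by rewrite xE; lra.
Qed.

(** In units of [tau], [g0 + g1 |s|] is the excess of failure over success; [9/10 a] is the
    forfeited gain. *)
Let g0 := 1 + 9 / 10 * a - 3479 / 1000 * E.
Let g1 := 109 / 50 * E.

(** The third expression is what [quad] averages to when [s] has mean 0 and second moment 1, in
    units of [tau a]. It has to stay below the success gain [9/10]. *)
Let g_bounds : [/\ 0 <= g0, 0 <= g1 &
  g0 * ((1 + a / 2) ^+ 2 + 1) / 4 + g1 * (1 + a / 2) <= 4 / 5].
Proof.
have /andP[a0 a1] := a_bounds; have /andP[E1 E2] := @expRN52_bounds R.
rewrite /g0 /g1; move: a0 a1 E1 E2; set A := a; set E' := expR _ => a0 a1 E1 E2.
split; [lra | lra|].
have h1 : (1 + A / 2) ^+ 2 <= 81 / 64.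
  have -> : 81 / 64 = (9 / 8) ^+ 2 :> R by field.
  by rewrite ler_pXn2r// ?nnegrE; lra.
have h2 : (1 + 9 / 10 * A - 3479 / 1000 * E') * ((1 + A / 2) ^+ 2 + 1) <=
   (49 / 40 - 3479 / 1000 * E') * (145 / 64).
  by apply: ler_pM; have := sqr_ge0 (1 + A / 2); lra.
have h3 : 109 / 50 * E' * (1 + A / 2) <= 109 / 50 * E' * (9 / 8).
  by rewrite ler_wpM2l//; lra.
by lra.
Qed.

Lemma coupling_bound_near_le (s u : R) :
  coupling_bound b r s u <= f r - 9 / 10 * tau * a + b +
    tau * (g0 + g1 * `|s|) * (~~ (u <= expR (- (a * s + a ^+ 2 / 2))))%:R.
Proof.
rewrite /coupling_bound (leNgt Rt r) rR /=; case: ifP => _ /=.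
  by rewrite mulr0 addr0 near_success_bound.
rewrite mulr1; apply: le_trans (near_failure_bound s) _.
by rewrite /g0 /g1; lra.
Qed.

Lemma near_base_ge0 : 0 <= f r - 9 / 10 * tau * a + b.
Proof.
apply: le_trans near_success_bound.
have f0 x : 0 <= f x.
  by have [x0|/ltW x0] := leP 0 x; [exact: fconc_ge0 | rewrite fconc_neg].
exact: f0.
Qed.

Context {dT : measure_display} {Omega : measurableType dT} (P : probability Omega R).
Variables (U Z : Omega -> R).
Hypotheses (mU : measurable_fun setT U) (hU : unif01 P U).

Lemma near_uniform_mean (s : R) :
  (\int[P]_w (coupling_bound b r s (U w))%:E <=
   (f r - 9 / 10 * tau * a + b + tau * (g0 + g1 * `|s|) * Num.max 0 (a * s + a ^+ 2 / 2))%:E)%E.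
Proof.
have [gp0 gp1 _] := g_bounds.
set y := a * s + a ^+ 2 / 2; set S := _ + b; set G := tau * _.
have S0 : 0 <= S by exact: near_base_ge0.
have G0 : 0 <= G by rewrite mulr_ge0 ?(ltW tau_gt0)// addr_ge0// mulr_ge0.
pose A := [set w | ~~ (U w <= expR (- y))].
have mA : measurable A.
  have -> : A = setT `&` U @^-1` `]expR (- y), +oo[%classic.
    by rewrite setTI; apply/seteqP; split => w /=; rewrite in_itv/= andbT ltNge.
  exact: mU.
apply: le_trans (_ : \int[P]_w (S%:E + G%:E * (\1_A w)%:E) <= _)%E.
  apply: ge0_le_integral_nonmeas => w; first by rewrite lee_fin coupling_bound_ge0.
  rewrite -EFinM -EFinD lee_fin; apply: le_trans (coupling_bound_near_le s (U w)) _.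
  rewrite /S /G lerD2l indicE; case: (boolP (U w <= _)) => h /=; first by rewrite mulr0 mulr_ge0.
  by rewrite mem_set.
have mI : measurable_fun setT (fun w => (\1_A w)%:E : \bar R).
  by apply/measurable_EFinP; exact: measurable_indic.
rewrite ge0_integralD//; last 2 first.
- by move=> w _; rewrite mule_ge0.
- exact: measurable_funeM.
have -> : (\int[P]_w S%:E = S%:E)%E.
  rewrite integral_cst//.
  exact: (etrans (congr1 (fun x => S%:E * x)%E (probability_setT P)) (mule1 _)).
rewrite ge0_integralZl// integral_indic// setIT [leRHS]EFinD; apply: leeD2l.
rewrite [leRHS]EFinM; apply: lee_wpmul2l; first by rewrite lee_fin.
exact: unif01_tail.
Qed.

Hypotheses (iZ : P.-integrable setT (fun w => (Z w)%:E)) (mean0 : Rintegral P setT Z = 0).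
Hypotheses (iZ2 : P.-integrable setT (fun w => (Z w ^+ 2)%:E))
  (var1 : Rintegral P setT (fun w => Z w ^+ 2) <= 1).

(* With [y = a s + a^2/2]: [max 0 y <= (y + a)^2 / (4 a)] and
   [|s| max 0 y <= a s^2 + a^2 (1 + s^2) / 4], so that only two moments of [s] matter. *)
Let quad (s : R) : tau * (g0 + g1 * `|s|) * Num.max 0 (a * s + a ^+ 2 / 2) <=
  tau * a * (g0 * (1 + a / 2) ^+ 2 / 4 + g1 * a / 4) + tau * a * (g0 * (1 + a / 2) / 2) * s
   + tau * a * (g0 / 4 + g1 * (1 + a / 4)) * s ^+ 2.
Proof.
have [gp0 gp1 _] := g_bounds; have /andP[a0 _] := a_bounds.
rewrite [leRHS](_ : _ = tau * (g0 * (a * (s + 1 + a / 2) ^+ 2 / 4) +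
  g1 * (a * s ^+ 2 + a ^+ 2 * (1 + s ^+ 2) / 4))); last by field.
rewrite -mulrA ler_pM2l// mulrDl; apply: lerD.
  rewrite ler_wpM2l// ge_max; apply/andP; split.
    by have := mulr_ge0 a0 (sqr_ge0 (s + 1 + a / 2)); lra.
  have := mulr_ge0 a0 (sqr_ge0 (s + a / 2 - 1)); lra.
rewrite -[leLHS]mulrA; apply: ler_wpM2l => //.
have s0 := normr_ge0 s; have ss : s <= `|s| by exact: ler_norm.
have s2 : `|s| ^+ 2 = s ^+ 2 by rewrite real_normK// num_real.
apply: le_trans (_ : `|s| * (a * `|s| + a ^+ 2 / 2) <= _).
  rewrite ler_wpM2l// ge_max; apply/andP; split.
    by have := mulr_ge0 a0 s0; have := sqr_ge0 a; lra.
  by rewrite lerD2r ler_wpM2l.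
have := mulr_ge0 (sqr_ge0 a) (sqr_ge0 (`|s| - 1)); rewrite -s2; nra.
Qed.

(** Failure costs on average at most [q0 + q2 <= 4/5 tau a], against the gain [9/10 tau a]. The
    remaining [tau a / 10] covers [2 rate f r], as [1/10 > 2/156]. *)
Lemma coupling_bound_near_mean :
  (\int[P]_w2 \int[P]_w3 (coupling_bound b r (Z w2) (U w3))%:E <=
    ((1 - 2 * rate) * f r + b)%:E)%E.
Proof.
have [gp0 gp1 gle] := g_bounds; have /andP[a0 a1] := a_bounds.
set S := f r - 9 / 10 * tau * a + b.
set q0 := tau * a * (g0 * (1 + a / 2) ^+ 2 / 4 + g1 * a / 4).
set q1 := tau * a * (g0 * (1 + a / 2) / 2).
set q2 := tau * a * (g0 / 4 + g1 * (1 + a / 4)).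
have ta : 0 <= tau * a by exact: mulr_ge0 (ltW tau_gt0) a0.
have q20 : 0 <= q2.
  apply: mulr_ge0 => //; apply: addr_ge0; first by rewrite divr_ge0.
  by apply: mulr_ge0 => //; lra.
have iC : P.-integrable setT (EFin \o (fun=> S + q0)) by exact: finite_measure_integrable_cst.
have i1 := integrableZl measurableT q1 iZ.
have i2 := integrableZl measurableT q2 iZ2.
have iQ := integrableD measurableT (integrableD measurableT iC i1) i2.
apply: le_trans (_ : \int[P]_w (S + q0 + q1 * Z w + q2 * Z w ^+ 2)%:E <= _)%E.
  apply: ge0_le_integral_nonmeas => w.
    by apply: integral_ge0 => w3 _; rewrite lee_fin coupling_bound_ge0.
  apply: le_trans (near_uniform_mean (Z w)) _; rewrite lee_fin -!addrA lerD2l.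
  by have := quad (Z w); rewrite -/q0 -/q1 -/q2 -!addrA; lra.
have -> : (\int[P]_w (S + q0 + q1 * Z w + q2 * Z w ^+ 2)%:E =
    (Rintegral P setT (fun w => (S + q0 + q1 * Z w) + q2 * Z w ^+ 2))%:E)%E.
  by rewrite /Rintegral fineK//; exact: (integrable_fin_num measurableT iQ).
rewrite (RintegralD measurableT (integrableD measurableT iC i1) i2).
rewrite (RintegralD measurableT iC i1) (RintegralZl _ measurableT iZ) (RintegralZl _ measurableT iZ2).
rewrite mean0 mulr0 addr0 Rintegral_prob_cst lee_fin.
have h1 : q2 * Rintegral P setT (fun w => Z w ^+ 2) <= q2 by rewrite ler_piMr.
have h2 : q0 + q2 <= 4 / 5 * (tau * a).
  rewrite [leRHS]mulrC; apply: le_trans (ler_wpM2l ta gle).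
  by rewrite le_eqVlt; apply/orP; left; apply/eqP; rewrite /q0 /q2; field.
have [gg0 Tg lg gR] := gammaC_facts L0 Rc0 T0 hT2 Rtp.
have /andP[k0 k2] := k1.
have kl : 4 * (K * T ^+ 2) <= L * T ^+ 2 by rewrite mulrA ler_wpM2r ?sqr_ge0.
have fr0 : 0 <= f r by exact: fconc_ge0.
have frr : f r <= r by exact: fconc_le.
(* Here [T gam] dominates [L T^2], hence [K T^2], while [r < Rt] makes [exp(-r/T)] dominate [e1]. *)
have h3 : K * T ^+ 2 * e1 * f r <= expR (- r / T) * (T * gam * r).
  apply: le_trans (_ : (K * T ^+ 2 * e1) * r <= _).
    by apply: ler_wpM2l => //; exact: mulr_ge0 k0 (ltW e1_gt0).
  have h : K * T ^+ 2 * e1 <= T * gam * expR (- r / T).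
    apply: ler_pM => //; first by lra.
    rewrite ler_expR !mulNr lerN2 ler_pdivrMr//.
    have -> : 5 * Rt / (4 * T) * T = 5 / 4 * Rt by field; rewrite gt_eqF.
    by have := rR; have := Rtp; lra.
  by have := ler_wpM2r r0 h; lra.
have h4 : tau * a = expR (- r / T) * (T * gam * r) by ring.
have h5 : 0 <= K * T ^+ 2 * e1 * f r by rewrite !mulr_ge0// ltW.
rewrite /S; move: h1 h2; rewrite -mulrA h4; lra.
Qed.

End Near.
End CouplingBound.

Lemma measurable_fun_sigma_gen_comp {R : realType} {dT : measure_display} {Omega : measurableType dT}
  (I : Type) (f : I -> Omega -> R) (i : I) (dS : measure_display) (S : measurableType dS)
  (g : S -> g_sigma_algebraType (sigma_gen_base f)) :
  measurable_fun setT g -> measurable_fun setT (fun s => f i (g s)).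
Proof. by move=> mg; exact: (measurableT_comp (@measurable_fun_sigma_gen _ _ _ _ f i) mg). Qed.

Lemma rvec_meas_unitdir {R : realType} {dT : measure_display} {S : measurableType dT} {d : nat}
  (X : S -> vec R d) : rvec_meas X -> rvec_meas (fun w => unitdir (X w)).
Proof.
move=> mX i.
have -> : (fun w => unitdir (X w) ord0 i) = (fun w => enorm (X w) `^ (-1) * X w ord0 i).
  by apply/funext => w; rewrite mxE powR_inv1// enorm_ge0.
apply: measurable_funM; last exact: mX.
exact: (measurableT_comp (measurable_powR (-1)) (measurable_fun_enorm mX)).
Qed.

Lemma measurable_coupling_bound_sigma_gen {R : realType} {d : nat} {dT : measure_display}
  {Omega : measurableType dT} (L K Rc T b : R) (X X' xi : Omega -> vec R d) (U : Omega -> R)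
  (f1 := fun (bi : bool * 'I_d) w => (if bi.1 then X w else X' w) ord0 bi.2)
  (f2 := fun (i : 'I_d) w => xi w ord0 i) (f3 := fun _ : unit => U)
  {dS : measure_display} {S : measurableType dS}
  (g1 : S -> g_sigma_algebraType (sigma_gen_base f1))
  (g2 : S -> g_sigma_algebraType (sigma_gen_base f2))
  (g3 : S -> g_sigma_algebraType (sigma_gen_base f3)) :
  0 < T -> 0 <= R1 L K Rc T ->
  measurable_fun setT g1 -> measurable_fun setT g2 -> measurable_fun setT g3 ->
  measurable_fun setT (fun s =>
    coupling_bound L K Rc T b (enorm (X (g1 s) - X' (g1 s)))
      (dotv (unitdir (X (g1 s) - X' (g1 s))) (xi (g2 s))) (U (g3 s))).
Proof.
move=> T0 R10 m1 m2 m3.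
have mX1 : rvec_meas (fun s => X (g1 s)).
  by move=> i; have := measurable_fun_sigma_gen_comp (true, i) m1.
have mX2 : rvec_meas (fun s => X' (g1 s)).
  by move=> i; have := measurable_fun_sigma_gen_comp (false, i) m1.
have mX3 : rvec_meas (fun s => xi (g2 s)).
  by move=> i; have := measurable_fun_sigma_gen_comp i m2.
have mU3 : measurable_fun setT (fun s => U (g3 s)).
  by have := measurable_fun_sigma_gen_comp tt m3.
have mZ := rvec_measB mX1 mX2.
apply: measurable_coupling_bound => //; first exact: measurable_fun_enorm.
by apply: measurable_fun_dotv => //; exact: rvec_meas_unitdir.
Qed.

(** * Pathwise domination by the coupling bound, and the contraction in mean *)

Section Pathwise.
Context {R : realType} {d : nat}.
Variables (L K Rc T D M : R).
Hypotheses (L0 : 0 < L) (K0 : 0 < K) (Rc0 : 0 <= Rc) (T0 : 0 < T) (D0 : 0 <= D) (M0 : 0 <= M).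
Local Notation Rt := (Rtilde L K Rc).
Hypothesis hT2 : L * T ^+ 2 <= 3 / 5 *
          (if Rt == 0 then 1 / 4
           else Num.min (1 / 4) (3 / (256 * 5 * L * Rt ^+ 2))).
Hypotheses (KL : 4 * K <= L) (DK : 1000 * D <= K).
Variables (z w De p : R -> vec R d) (v : vec R d) (u : R).
Hypothesis path : newton_path T z w (fun t => De t + p t).
Hypothesis De_le : forall t : R, 0 < t < T -> enorm (De t) <= L * enorm (z t).
Hypothesis p_le : forall t : R, 0 < t < T -> enorm (p t) <= D * (enorm (z t) + M).
Hypothesis coer : forall t : R, 0 < t < T -> Rc <= enorm (z t) ->
  K * enorm (z t) ^+ 2 + L^-1 * enorm (De t) ^+ 2 <= dotv (z t) (De t).
Hypothesis w0 : w 0 = v - coupled_eta L K Rc T (z 0) v u.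

(** Equality fails at [x = 0], where [unitdir] is 0 by convention. *)
Lemma enorm_unitdir_le1 (x : vec R d) : enorm (unitdir x) <= 1.
Proof.
rewrite /unitdir enormZ; have [->|x0] := eqVneq x 0; first by rewrite enorm0 mulr0.
rewrite ger0_norm ?invr_ge0 ?enorm_ge0// mulVf//.
by rewrite gt_eqF// enorm_gt0.
Qed.

Lemma pathwise_coupling_bound :
  fconc L K Rc T (enorm (z T)) <=
  coupling_bound L K Rc T (8 / 5 * (D * T ^+ 2 * M)) (enorm (z 0))
    (dotv (unitdir (z 0)) v) u.
Proof.
have LT := LT2_le hT2.
rewrite /coupling_bound; case: ifPn => [Rr|].
  apply: fconc_mono => //; first exact: enorm_ge0.
  apply: (far_contraction L0 K0 Rc0 T0 D0 M0 LT KL DK path De_le p_le) => //.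
  by rewrite w0 /coupled_eta Rr subrr.
rewrite -ltNge => rR; have r0 := enorm_ge0 (z 0).
have Rtp : 0 < Rt by exact: le_lt_trans r0 rR.
have [g0 Tg lg gR] := gammaC_facts L0 Rc0 T0 hT2 Rtp.
move: w0; rewrite /coupled_eta (leNgt Rt) rR/= normal_pdf_ratio.
case: ifP => _ w0'; apply: fconc_mono => //; try exact: enorm_ge0.
  apply: (near_contraction L0 K0 T0 D0 M0 LT KL DK path De_le p_le) => //; first exact: ltW.
  by rewrite w0' opprD addrA subrr add0r.
apply: (near_growth L0 K0 T0 D0 M0 LT KL DK path De_le p_le) => //.
- apply: le_trans (LTRt_le L0 Rc0 T0 hT2).
  by rewrite ler_wpM2l ?mulr_ge0 ?(ltW L0) ?(ltW T0) ?(ltW rR).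
(* Reflection leaves the relative momentum [2 (e.v) e]. *)
- rewrite w0' opprB addrC subrK enormZ normrM ger0_norm//.
  by rewrite ler_piMr ?mulr_ge0// enorm_unitdir_le1.
Qed.

End Pathwise.

Lemma integrable_enorm_of_second_moment {R : realType} {dT : measure_display}
  {Omega : measurableType dT} (P : probability Omega R) {d : nat} (X : Omega -> vec R d) :
  rvec_meas X -> finite_second_moment P X -> P.-integrable setT (fun w => (enorm (X w))%:E).
Proof.
move=> mX fX; have mn := measurable_fun_enorm mX.
have i2 : P.-integrable setT (fun w => ((enorm (X w)) ^+ 2)%:E).
  apply/integrableP; split; first by apply/measurable_EFinP; exact: measurable_funX.
  by under eq_integral do rewrite gee0_abs ?lee_fin ?sqr_ge0//.
have i1 : P.-integrable setT (EFin \o (fun=> 1 : R)) by exact: finite_measure_integrable_cst.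
apply: (le_integrable measurableT) (integrableD measurableT i1 i2).
  exact/measurable_EFinP.
move=> w _ /=; have n0 := enorm_ge0 (X w); rewrite lee_fin !ger0_norm ?addr_ge0 ?sqr_ge0//.
by have := sqr_ge0 (enorm (X w) - 1); nra.
Qed.

Lemma integrable_enorm_gaussian {R : realType} {dT : measure_display}
  {Omega : measurableType dT} (P : probability Omega R) {d : nat} (xi : Omega -> vec R d) :
  rvec_meas xi -> std_gaussian P xi -> P.-integrable setT (fun w => (enorm (xi w))%:E).
Proof.
move=> mxi gxi.
have ii i : P.-integrable setT (fun w => `|xi w ord0 i|%:E).
  exact: (integrable_abse (gaussian_integrable (mxi i) (std_gaussian_marginal gxi i))).
have [h _] := Rintegral_sum (index_enum 'I_d) ii.
apply: (le_integrable measurableT) h.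
  by apply/measurable_EFinP; exact: measurable_fun_enorm.
move=> w _ /=; rewrite lee_fin (ger0_norm (enorm_ge0 _)).
by apply: le_trans (enorm_le_sum _) (ler_norm _).
Qed.

(** One factor [e1 E] of the bound on [D] converts [I] into [Ef]. With the other, the error is at
    most [8/5 * 11/10 * 5/384 * 2/15] times [k e1 Ef], and this number is below [1/156]. *)
Lemma mean_contraction_arith {R : realFieldType} (D M I E k e1 Ef : R) :
  0 <= D -> 0 <= k -> 0 <= e1 -> 0 <= E <= 2 / 15 -> 0 <= Ef ->
  D <= 5 / 384 * k * (e1 * E) ^+ 2 -> 0 <= I -> e1 * E * I <= Ef -> M <= 11 / 10 * I ->
  (1 - 2 * (k / 156 * e1)) * Ef + 8 / 5 * (D * M) <= (1 - k / 156 * e1) * Ef.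
Proof.
move=> D0 k0 e10 /andP[E0 E1] Ef0 hD I0 EI ME.
have bE := ler_wpM2l D0 ME.
have dE : D * I <= 5 / 384 * k * (e1 * E) * Ef.
  have p0 : 0 <= 5 / 384 * k * (e1 * E).
    exact: mulr_ge0 (mulr_ge0 (divr_ge0 (ler0n _ _) (ler0n _ _)) k0) (mulr_ge0 e10 E0).
  by have := ler_wpM2l p0 EI; have := ler_wpM2r I0 hD; rewrite expr2; lra.
have X0 : 0 <= k * e1 * Ef by rewrite !mulr_ge0.
have := ler_wpM2r X0 E1; lra.
Qed.

Theorem mainTheorem2 (R : realType) (d : nat)
  (V : vec R d -> R) (gV : vec R d -> vec R d)
  (W : vec R d -> vec R d -> R) (g1W : vec R d -> vec R d -> vec R d)
  (L K Rc Lt : R)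
  (* gV is the gradient of V, g1W the gradient of W in its first argument *)
  (hV : forall x, differentiable V x /\ forall h, 'd V x h = dotv (gV x) h)
  (hW : forall x y, differentiable (fun z => W z y) x /\
                    forall h, 'd (fun z => W z y) x h = dotv (g1W x y) h)
  (hL : 0 < L) (hK : 0 < K) (hRc : 0 <= Rc) (hLt : 0 <= Lt)
  (* (a) *)
  (ha0 : V 0 = 0) (ha1 : forall x, 0 <= V x)
  (* (b) *)
  (hb : forall x y, enorm (gV x - gV y) <= L * enorm (x - y))
  (* (c) *)
  (hc : forall x y, Rc <= enorm (x - y) ->
          K * enorm (x - y) ^+ 2 + L^-1 * enorm (gV x - gV y) ^+ 2
          <= dotv (x - y) (gV x - gV y))
  (* (d) *)
  (hdsym : forall x y, W x y = W y x)
  (hdlip : forall x y x' y',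
          enorm (g1W x y - g1W x' y') <= Lt * (enorm (x - x') + enorm (y - y')))
  (T eps : R) (hT : 0 < T) (heps : 0 <= eps)
  (hT2 : L * T ^+ 2 <= 3 / 5 *
          (if Rtilde L K Rc == 0 then 1 / 4
           else Num.min (1 / 4) (3 / (256 * 5 * L * Rtilde L K Rc ^+ 2))))
  (hepsL : eps * Lt <= 5 / 64 * (K / Num.sqrt (7 / 6 + 3 / (2 * K * T ^+ 2)))
            * expR (- (5 * Rtilde L K Rc) / (2 * T) - 5))
  (* probability space carrying x, x', xi, U *)
  (dT : measure_display) (Omega : measurableType dT) (P : probability Omega R)
  (X X' xi : Omega -> vec R d) (U : Omega -> R)
  (hXm : rvec_meas X) (hX'm : rvec_meas X') (hxim : rvec_meas xi)
  (hUm : measurable_fun setT U)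
  (* mubar = Law(X), mubar' = Law(X') have finite second moments *)
  (hX2 : finite_second_moment P X) (hX'2 : finite_second_moment P X')
  (hxi : std_gaussian P xi) (hU : unif01 P U)
  (* (x, x'), xi, U mutually independent *)
  (hind : indep3 P
     (sigma_gen (fun bi : bool * 'I_d => fun w => (if bi.1 then X w else X' w) ord0 bi.2))
     (sigma_gen (fun i : 'I_d => fun w => xi w ord0 i))
     (sigma_gen (fun _ : unit => U)))
  (* nonlinear dynamics for mubar and mubar' *)
  (qb pb qb' pb' : R -> vec R d -> vec R d -> vec R d)
  (hsol : nl_solution P gV g1W eps T X xi qb pb)
  (hsol' : nl_solution P gV g1W eps T X' xi qb' pb') :
  let eta := fun w => coupled_eta L K Rc T (X w - X' w) (xi w) (U w) in
  let c := K * T ^+ 2 / 156 * expR (- (5 * Rtilde L K Rc) / (4 * T)) in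
  (\int[P]_w (rho L K Rc T (qb T (X w) (xi w)) (qb' T (X' w) (eta w)))%:E
   <= (1 - c)%:E * \int[P]_w (rho L K Rc T (X w) (X' w))%:E)%E.
Proof.
pose eta w := coupled_eta L K Rc T (X w - X' w) (xi w) (U w).
pose c := K * T ^+ 2 / 156 * expR (- (5 * Rtilde L K Rc) / (4 * T)).
suff : (\int[P]_w (rho L K Rc T (qb T (X w) (xi w)) (qb' T (X' w) (eta w)))%:E
   <= (1 - c)%:E * \int[P]_w (rho L K Rc T (X w) (X' w))%:E)%E by [].
have T1 : 0 <= T by exact: ltW.
(* In dimension 0 both sides vanish; [4 K <= L] is available only for [d > 0]. *)
case: (posnP d) => [d_eq0|dpos].
  have n0 (v : vec R d) : enorm v = 0.
    by rewrite /enorm /dotv big1 ?sqrtr0// => i; exfalso; move: (ltn_ord i); rewrite [X in (_ < X)%N]d_eq0.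
  have I0 (g h : Omega -> vec R d) : (\int[P]_w (rho L K Rc T (g w) (h w))%:E = 0)%E.
    rewrite -[RHS](integral0 P setT); apply: eq_integral => w _.
    by rewrite /rho n0 fconc0.
  have zero (A B : \bar R) x : (A = 0 -> B = 0 -> A <= x%:E * B)%E.
    by move=> -> ->; rewrite mule0.
  exact: zero (I0 _ _) (I0 _ _).
have KL := quarter_of_coercive dpos hL hRc hc.
pose D := eps * Lt; have D0 : 0 <= D by exact: mulr_ge0.
set Rt := Rtilde L K Rc in hT2 hepsL c *.
pose e1 := expR (- (5 * Rt) / (4 * T)); pose E := expR (- (5 / 2)) : R.
have R10 : 0 <= R1 L K Rc T by exact: R1_ge0.
have e1_gt0 : 0 < e1 by exact: expR_gt0.
have e1_le1 : e1 <= 1.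
  rewrite /e1 -expR0 ler_expR mulNr oppr_le0 divr_ge0// mulr_ge0// Rtilde_ge0//.
have /andP[E1 E2] := @expRN52_bounds R; rewrite -/E in E1 E2.
have E0 : 0 < E by exact: expR_gt0.
have LT := LT2_le hT2.
have kl : 4 * K * T ^+ 2 <= L * T ^+ 2 by rewrite ler_wpM2r// sqr_ge0.
have k0 : 0 <= K * T ^+ 2 by rewrite mulr_ge0 ?sqr_ge0// ltW.
have hD : D <= 5 / 384 * K * (e1 * E) ^+ 2 by exact: coupling_constant_le.
have eE : (e1 * E) ^+ 2 <= (2 / 15) ^+ 2.
  have h : e1 * E <= 2 / 15 by apply: le_trans E2; rewrite ler_piMl// ltW.
  by rewrite ler_pXn2r// nnegrE// mulr_ge0// ltW.
have DK : 1000 * D <= K.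
  have := ler_wpM2l (ltW hK) eE; rewrite expr2; have := hK.
  by move: hD; rewrite expr2; lra.
have DT : 1000 * (D * T ^+ 2) <= K * T ^+ 2 by rewrite mulrA ler_wpM2r ?sqr_ge0.
have iX := integrable_enorm_of_second_moment hXm hX2.
have iX' := integrable_enorm_of_second_moment hX'm hX'2.
have ixi := integrable_enorm_gaussian hxim hxi.
have lT : (L + D) * T ^+ 2 <= 4 / 25 by rewrite mulrDl; lra.
have dT1 : 1000 * (D * T ^+ 2) <= 1 by lra.
have [M [M0 ME force]] := nl_synchronous hL hLt hT heps hb hdlip hxim ixi hsol hsol' hXm hX'm iX iX' lT dT1.
pose b := 8 / 5 * (D * T ^+ 2 * M).
have b0 : 0 <= b by rewrite mulr_ge0// mulr_ge0// mulr_ge0// sqr_ge0.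
pose r w := enorm (X w - X' w).
have r0 w : 0 <= r w by exact: enorm_ge0.
have mr : measurable_fun setT r by apply: measurable_fun_enorm; exact: rvec_measB.
have pathwise w : rho L K Rc T (qb T (X w) (xi w)) (qb' T (X' w) (eta w)) <=
    coupling_bound L K Rc T b (r w) (dotv (unitdir (X w - X' w)) (xi w)) (U w).
  have path := nl_path (X w) (xi w) (X' w) (eta w) hsol hsol'.
  have [init _ _ _ _] := hsol; have [init' _ _ _ _] := hsol'.
  have := pathwise_coupling_bound hL hK hRc hT D0 M0 hT2 KL DK path _ _ _ (v := xi w) (u := U w).
  rewrite (init _ _).1 (init' _ _).1 (init _ _).2 (init' _ _).2; apply => //.
  move=> t /andP[t0 tT]; apply: force; rewrite !ltW//.
  by move=> t _; exact: hc.
pose f1 (bi : bool * 'I_d) (w : Omega) := (if bi.1 then X w else X' w) ord0 bi.2.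
pose f2 (i : 'I_d) (w : Omega) := xi w ord0 i.
pose f3 (_ : unit) := U.
have mf1 bi : measurable_fun setT (f1 bi) by case: bi => -[] i; [exact: hXm | exact: hX'm].
have GM1 := sigma_gen_base_measurable mf1.
have GM2 := @sigma_gen_base_measurable _ _ _ _ f2 hxim.
have GM3 := @sigma_gen_base_measurable _ _ _ _ f3 (fun=> hUm).
pose S1 := g_sigma_algebraType (sigma_gen_base f1).
pose S2 := g_sigma_algebraType (sigma_gen_base f2).
pose S3 := g_sigma_algebraType (sigma_gen_base f3).
(* The pair [(X, X')], the Gaussian and the uniform variable are read from three separate copies of
   [Omega]; on the diagonal [F] is the pathwise bound. *)
pose F (s : S1 * (S2 * S3)) : \bar R :=
  (coupling_bound L K Rc T b (enorm (X s.1 - X' s.1))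
    (dotv (unitdir (X s.1 - X' s.1)) (xi s.2.1)) (U s.2.2))%:E.
have F0 s : (0 <= F s)%E by rewrite lee_fin; apply: coupling_bound_ge0 => //; exact: enorm_ge0.
have mF : measurable_fun setT F.
  apply/measurable_EFinP; apply: (@measurable_coupling_bound_sigma_gen _ _ _ _
    L K Rc T b X X' xi U _ (S1 * (S2 * S3))%type fst (fst \o snd) (snd \o snd)) => //.
    exact: (measurableT_comp measurable_fst measurable_snd).
  exact: (measurableT_comp measurable_snd measurable_snd).
have inner w1 : (\int[P]_w2 \int[P]_w3 F (w1, (w2, w3)) <=
    ((1 - 2 * c) * fconc L K Rc T (r w1) + b)%:E)%E.
  have [Rr|rR] := leP Rt (r w1).
    apply: le_trans (_ : \int[P]_w2 \int[P]_w3 ((1 - 2 * c) * fconc L K Rc T (r w1) + b)%:E <= _)%E.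
      apply: ge0_le_integral_nonmeas => w2; first exact: integral_ge0.
      apply: ge0_le_integral_nonmeas => w3 //.
      by rewrite lee_fin; exact: coupling_bound_far.
    have cstE (x : R) : (\int[P]_w x%:E = x%:E)%E.
      by rewrite integral_cst//; exact: (etrans (congr1 (fun y => x%:E * y)%E (probability_setT P)) (mule1 _)).
    by under eq_integral do rewrite cstE; rewrite cstE.
  set e := unitdir (X w1 - X' w1).
  have [iZ Z0] := std_gaussian_dot_mean0 hxim hxi e.
  have [iZ2 Z1] := std_gaussian_dot_second_moment hxim hxi e.
  apply: (coupling_bound_near_mean hL hK hRc hT KL hT2 b0 (r0 w1) rR hUm hU iZ Z0 iZ2).
  apply: le_trans Z1 _; rewrite -enorm_sqr expr_le1// ?enorm_ge0//.
  exact: enorm_unitdir_le1.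
have mfr : measurable_fun setT (fun w => fconc L K Rc T (r w)).
  exact: (measurableT_comp (measurable_fconc hT R10) mr).
have ir : P.-integrable setT (fun w => (r w)%:E).
  apply: (le_integrable measurableT) (integrableD measurableT iX iX').
    exact/measurable_EFinP.
  move=> w _ /=; rewrite lee_fin !ger0_norm ?addr_ge0 ?enorm_ge0//.
  by rewrite /r -(enormN (X' w)) enormD.
have ifr : P.-integrable setT (fun w => (fconc L K Rc T (r w))%:E).
  apply: (le_integrable measurableT) ir; first exact/measurable_EFinP.
  by move=> w _ /=; rewrite lee_fin !ger0_norm ?fconc_ge0//; exact: fconc_le.
pose Ef := Rintegral P setT (fun w => fconc L K Rc T (r w)).
have EfE : (\int[P]_w (rho L K Rc T (X w) (X' w))%:E = Ef%:E)%E.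
  by rewrite /Ef /Rintegral fineK//; exact: (integrable_fin_num measurableT ifr).
have subst (A B : \bar R) x y : B = y%:E -> (A <= (x * y)%:E -> A <= x%:E * B)%E.
  by move=> ->; rewrite EFinM.
apply: subst EfE _.
apply: le_trans (_ : \int[P]_w F (w, (w, w)) <= _)%E.
  apply: ge0_le_integral_nonmeas => w; rewrite lee_fin; last exact: pathwise.
  by apply: fconc_ge0 => //; exact: enorm_ge0.
rewrite (tonelli_indep3 GM1 GM2 GM3 hind mF F0).
apply: le_trans (_ : \int[P]_w ((1 - 2 * c) * fconc L K Rc T (r w) + b)%:E <= _)%E.
  apply: ge0_le_integral_nonmeas => w1; last exact: inner.
  by apply: integral_ge0 => w2 _; exact: integral_ge0.
have ib : P.-integrable setT (EFin \o (fun=> b)) by exact: finite_measure_integrable_cst.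
have i1 := integrableZl measurableT (1 - 2 * c) ifr.
have -> : (\int[P]_w ((1 - 2 * c) * fconc L K Rc T (r w) + b)%:E = ((1 - 2 * c) * Ef + b)%:E)%E.
  rewrite /Ef -(RintegralZl _ measurableT ifr) -[in RHS](Rintegral_prob_cst P b).
  rewrite -(RintegralD measurableT i1 ib) /Rintegral fineK//.
  exact: (integrable_fin_num measurableT (integrableD measurableT i1 ib)).
rewrite lee_fin.
(* The converse comparison of [f] with the Euclidean distance, from its least slope
   [exp(-R1/T) = e1 E]. *)
have Er : e1 * E * Rintegral P setT r <= Ef.
  rewrite -(RintegralZl _ measurableT ir); apply: le_Rintegral => //.
    exact: (integrableZl measurableT (e1 * E) ir).
  by move=> w _; rewrite -expR_R1//; exact: fconc_ge.
have Ef0 : 0 <= Ef by apply: Rintegral_ge0 => w _; exact: fconc_ge0.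
apply: (mean_contraction_arith (D := D * T ^+ 2) (M := M) (I := Rintegral P setT r) (E := E)) => //.
- by rewrite mulr_ge0 ?sqr_ge0.
- by rewrite (ltW E0).
- by apply: le_trans (ler_wpM2r (sqr_ge0 T) hD) _; rewrite mulrAC -(mulrA _ K).
- by apply: Rintegral_ge0 => w _; exact: r0.
Qed.
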